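(* Let $D$ be a two-dimensional regular local ring with fixed regular system of parameters $x,y$, let $0<a<b$ be real numbers, and let $I=[a,b]$. Then the interval ring $T_I$ satisfies the ascending chain condition on principal ideals, and $T_I$ is atomic, i.e. every nonzero non-unit element of $T_I$ is a finite product of irreducible elements.
   Context: $D$ is a two-dimensional regular local ring with maximal ideal $\mathfrak m=(x,y)$ and quotient field $K$. Every nonzero element of $D$ can be written as $u_1\tau_1+\cdots+u_n\tau_n$ with $u_i$ units of $D$ and $\tau_i$ distinct monomials $x^py^q$ ($p,q\ge 0$ integers), none of which divides another in $D$; the set of monomials $\tau_i$ is uniquely determined by the element (and $x,y$). For real $r>0$, the monomial valuation $v_r$ on $K$ is defined by $v_r(0)=\infty$, $v_r(x^py^q)=p+qr$, $v_r(u_1\tau_1+\cdots+u_n\tau_n)=\min_i v_r(\tau_i)$ for such a representation, and $v_r(f/g)=v_r(f)-v_r(g)$ for $f,g\in D$, $g\neq 0$. Its valuation ring is $V_r=\{f\in K: v_r(f)\ge 0\}$. For $I=[a,b]$ the interval ring $T_I$ is the intersection of all valuation rings $V$ such that $D\subseteq V\subseteq V_r$ for some $r\in I$. *)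

(* Defs.v *)
From HB Require Import structures.
From mathcomp Require Import all_boot all_order all_algebra.
From mathcomp Require Import all_classical all_reals.

Set Implicit Arguments.
Unset Strict Implicit.
Unset Printing Implicit Defensive.

Import Order.TTheory GRing.Theory Num.Theory.
Local Open Scope ring_scope.

Section RingNotions.
Variable A : idomainType.

(* The library's [idealr_closed] describes proper ideals only; here [J] may be
   the whole ring. *)
Definition is_ideal (J : {pred A}) : Prop :=
  0 \in J /\ forall c, {in J &, forall u v, c * u + v \in J}.

Definition noetherian : Prop :=
  forall J : {pred A}, is_ideal J ->
  exists (n : nat) (g : 'I_n -> A),
    forall z, z \in J <-> exists c : 'I_n -> A, z = \sum_(i < n) c i * g i.

Definition prime_ideal (P : {pred A}) : Prop :=
  idealr_closed P /\ prime_idealr_closed P.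

Definition maximal_ideal (M : {pred A}) : Prop :=
  idealr_closed M /\
  forall J : {pred A}, idealr_closed J -> {subset M <= J} -> {subset J <= M}.

(* A chain P 0 < P 1 < ... < P n of prime ideals; P i is irrelevant for i > n. *)
Definition prime_chain (n : nat) (P : nat -> {pred A}) : Prop :=
  (forall i, (i <= n)%N -> prime_ideal (P i)) /\
  (forall i, (i < n)%N ->
     {subset P i <= P i.+1} /\ ~ {subset P i.+1 <= P i}).

Definition has_krull_dim (d : nat) : Prop :=
  (exists P, prime_chain d P) /\
  (forall n P, prime_chain n P -> (n <= d)%N).

(* The last clause says at once that A is local and that its maximal ideal
   is (x, y). *)
Definition regular_local_ring2 (x y : A) : Prop :=
  [/\ noetherian,
      has_krull_dim 2 &
      forall M : {pred A}, maximal_ideal M <->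
        (forall z, z \in M <-> exists c d, z = c * x + d * y)].

Definition principal_ideal (c : A) : set A := [set z | exists t, z = c * t].

Definition accp : Prop :=
  forall f : nat -> A,
    (forall n, principal_ideal (f n) `<=` principal_ideal (f n.+1))%classic ->
    exists N, forall n, (N <= n)%N ->
      principal_ideal (f n) = principal_ideal (f N).

Definition irreducible_elt (p : A) : Prop :=
  [/\ p != 0, p \isn't a GRing.unit &
      forall s t, p = s * t -> s \is a GRing.unit \/ t \is a GRing.unit].

Definition atomic : Prop :=
  forall z : A, z != 0 -> z \isn't a GRing.unit ->
  exists s : seq A,
    (forall p, p \in s -> irreducible_elt p) /\ z = \prod_(p <- s) p.

End RingNotions.

Section IntervalRing.
Variables (D : idomainType) (R : realType) (x y : D).
Local Notation K := {fraction D}.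

Definition monomial (e : nat * nat) : D := x ^+ e.1 * y ^+ e.2.

(* The list [s] of pairs (u_i, exponents of tau_i) is a representation
   f = u_1 tau_1 + ... + u_n tau_n; non-divisibility at distinct positions
   includes distinctness of the tau_i. *)
Definition monomial_rep (f : D) (s : seq (D * (nat * nat))) : Prop :=
  [/\ f = \sum_(t <- s) t.1 * monomial t.2,
      (forall t, t \in s -> t.1 \is a GRing.unit) &
      (forall i j, (i < size s)%N -> (j < size s)%N -> i != j ->
         let tau (k : nat) := monomial (nth (0, (0%N, 0%N)) s k).2 in
         ~ exists d, tau j = d * tau i)].

Definition monomial_weight (r : R) (e : nat * nat) : R := e.1%:R + e.2%:R * r.

(* Under [regular_local_ring2] every nonzero f has a representation and its set
   of monomials does not depend on the choice, so [xget] is harmless. *)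
Definition monomial_val_D (r : R) (f : D) : \bar R :=
  if f == 0 then +oo%E
  else \big[Order.min/+oo%E]_(t <- xget [::] [set s | monomial_rep f s]%classic)
         (monomial_weight r t.2)%:E.

(* v_r (f / g) = v_r f - v_r g, computed on the fraction chosen by [repr]. *)
Definition monomial_val (r : R) (z : K) : \bar R :=
  (monomial_val_D r \n_(repr z) - monomial_val_D r \d_(repr z))%E.

Definition monomial_valring (r : R) : {pred K} :=
  [pred z | 0%E <= monomial_val r z]%O.

Definition valuation_ring (V : {pred K}) : Prop :=
  subring_closed V /\ forall z, z != 0 -> (z \in V) || (z^-1 \in V).

Definition interval_ring_pred (I : interval R) : {pred K} :=
  [pred z | `[< forall V : {pred K},
      valuation_ring V ->
      (forall d : D, FracField.tofrac d \in V) ->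
      (exists2 r, r \in I & {subset V <= monomial_valring r}) ->
      z \in V >]].

Fact interval_ring_pred_closed (I : interval R) :
  subring_closed (interval_ring_pred I).
Proof.
split=> [|u v /asboolP hu /asboolP hv|u v /asboolP hu /asboolP hv];
  apply/asboolP=> V hV hD hI.
- by case: hV => -[].
- by case: (hV) => -[_ hB _] _; apply: hB; [exact: hu|exact: hv].
- by case: (hV) => -[_ _ hM] _; apply: hM; [exact: hu|exact: hv].
Qed.

HB.instance Definition _ (I : interval R) :=
  GRing.isSubringClosed.Build K (interval_ring_pred I)
    (interval_ring_pred_closed I).

Record interval_ring (I : interval R) := IntervalRing {
  interval_ring_val :> K;
  _ : interval_ring_val \in interval_ring_pred I }.

Variable I : interval R.
Local Notation T := (interval_ring I).

HB.instance Definition _ := [isSub for @interval_ring_val I].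
HB.instance Definition _ := [Choice of T by <:].
HB.instance Definition _ := [SubChoice_isSubComNzRing of T by <:].

(* The units of T_I are the elements having an inverse in T_I. *)
Definition interval_ring_unit : {pred T} := [pred u : T | `[< exists v : T, v * u = 1 >]].
Definition interval_ring_inv (u : T) : T := xget u [set v | v * u = 1]%classic.

Fact interval_ring_mulVr :
  {in interval_ring_unit, left_inverse 1 interval_ring_inv *%R}.
Proof.
move=> u /asboolP [v vu1]; rewrite /interval_ring_inv.
by case: xgetP => [w _ //|/(_ v)].
Qed.

Fact interval_ring_unitP u v : v * u = 1 -> u \in interval_ring_unit.
Proof. by move=> vu1; apply/asboolP; exists v. Qed.

Fact interval_ring_inv_out :
  {in [predC interval_ring_unit], interval_ring_inv =1 id}.
Proof.
move=> u; rewrite inE => /asboolP hu; rewrite /interval_ring_inv.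
by case: xgetP => // w _ wu1; case: hu; exists w.
Qed.

HB.instance Definition _ := GRing.ComNzRing_hasMulInverse.Build T
  interval_ring_mulVr interval_ring_unitP interval_ring_inv_out.

Fact interval_ring_integral : GRing.integral_domain_axiom T.
Proof.
move=> u v uv0; rewrite -!(inj_eq val_inj) !rmorph0 -mulf_eq0.
by rewrite -rmorphM uv0 rmorph0.
Qed.

HB.instance Definition _ := GRing.ComUnitRing_isIntegral.Build T
  interval_ring_integral.

End IntervalRing.

(* Main.v *)
From HB Require Import structures.
Require Import Defs.
From mathcomp Require Import all_boot all_order all_algebra.
From mathcomp Require Import all_classical all_reals ring lra.
Set Implicit Arguments.
Unset Strict Implicit.
Unset Printing Implicit Defensive.
Import Order.TTheory GRing.Theory Num.Theory.
Local Open Scope ring_scope.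

(** Write T for the interval ring and M_r for the maximal ideal of V_r.  The
    point is that a nonzero t in T with v_r(t) = 0 for one r in [a, b] satisfies
    v_s(t) = 0 for all s in [a, b], and is then a unit of T.  A rational r in
    [a, b] makes v_r discrete, so a suitable integer multiple of v_r is an
    additive length on T with values in nat that vanishes exactly on the units
    ([accp_atomic_of_length]); both conclusions follow.

    The function s |-> v_s(t) is nonnegative on [a, b] and Lipschitz
    ([val_lipschitz]), since on D it is a minimum of finitely many functions
    p + q s.  Its zero set is thus closed, and as [a, b] is connected it has to
    be shown that it is also open ([val_eq0_near]).  If v_r(t) = 0, then t lies
    in the subring D[1/t] + M_r of K: otherwise Chevalley's extension theorem
    ([exists_valuation_ring_avoiding]) yields a valuation ring V that contains
    this subring but not t; containing M_r and different from K, it lies in V_r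
    ([sub_monomial_valring]), which contradicts t in T.  Multiplying
    t = c_0 + c_1/t + ... + c_n/t^n + m by a power of t, after moving the last
    terms into m until c_n is a unit of D, gives p in T with t p - 1 in M_r
    ([interval_ring_invertible_mod]).  As v_s(t p - 1) > 0 for s close to r,
    also v_s(t) = 0 for these s.  If v_r(t) = 0 on all of [a, b], the same
    relation shows that 1/t lies in every V that defines T.

    That v_r is a valuation rests on the fact that x is a prime element
    ([x_prime]) that divides no power of y ([x_ndiv_pow_y]), a case of Krull's
    principal ideal theorem.  Therefore a monomial never lies in an ideal
    generated by monomials that do not divide it ([monomial_notin]), and every
    nonzero element has a unique leading exponent for the monomial order that
    compares weights p + q r first; leading exponents add up under products. *)

(** * Zorn's lemma above a given set, and Chevalley's extension theorem *)

(** [Zorn_bigcup] asks for the union of the empty chain as well; here the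
    starting set [A] takes care of it. *)
Lemma zorn_above (T : Type) (P : set (set T)) (A : set T) : P A ->
  (forall F : set (set T), (F !=set0)%classic -> (F `<=` P)%classic ->
     total_on F subset -> P (\bigcup_(X in F) X)%classic) ->
  exists B, [/\ P B, (A `<=` B)%classic &
    forall C, P C -> (B `<=` C)%classic -> (C `<=` B)%classic].
Proof.
move=> PA chain.
(* the empty set is admitted as the union of the empty chain *)
pose Q X := X = set0 \/ P X /\ (A `<=` X)%classic.
have [F FQ Ftot|M [QM maxM]] := @Zorn_bigcup T Q.
  have [[X0 [FX0 [PX0 AX0]]]|noX] :=
      pselect (exists X, F X /\ P X /\ (A `<=` X)%classic); last first.
    left; rewrite -subset0 => z [X FX Xz].
    by case: (FQ X FX) => [X0|PX]; [rewrite X0 in Xz|case: noX; exists X].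
  right; split; last by move=> z Az; exists X0 => //; exact: AX0.
  pose F' := [set X | F X /\ P X]%classic.
  have -> : (\bigcup_(X in F) X = \bigcup_(X in F') X)%classic.
    apply/seteqP; split=> z [X FX Xz].
      by exists X => //; split=> //; case: (FQ X FX) => [X0E|[]//];
         rewrite X0E in Xz.
    by exists X => //; case: FX.
  apply: chain; [by exists X0|by move=> X []|].
  by move=> X Y [FX _] [FY _]; exact: Ftot.
case: QM => [M0|[PM AM]].
  exists A; split=> // C PC AC; apply: contrapT => nCA.
  apply: (maxM C); last by right.
  split=> [|CM]; first by rewrite M0; apply: sub0set.
  by apply: nCA => z Cz; have := CM z Cz; rewrite M0.
exists M; split=> // C PC MC; apply: contrapT => nCM.
by apply: (maxM C) => //; right; split=> // z /AM /MC.
Qed.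

Section Chevalley.
Variable K : fieldType.
Implicit Types (z t : K).

Definition adjoin (B : {pred K}) z : {pred K} :=
  [pred v | `[< exists2 p, p \is a polyOver B & v = p.[z] >]].

Lemma adjoinP (B : subringClosed K) z v :
  reflect (exists2 p, p \is a polyOver B & v = p.[z]) (v \in adjoin B z).
Proof. exact: asboolP. Qed.

Lemma adjoin_closed (B : subringClosed K) z : subring_closed (adjoin B z).
Proof.
split=> [|_ _ /adjoinP[p pB ->] /adjoinP[q qB ->]|
          _ _ /adjoinP[p pB ->] /adjoinP[q qB ->]]; apply/adjoinP.
- by exists 1; rewrite ?rpred1 ?hornerC.
- by exists (p - q); rewrite ?rpredB ?hornerD ?hornerN.
- by exists (p * q); rewrite ?rpredM ?hornerM.
Qed.

Lemma adjoin_base (B : subringClosed K) z : {subset B <= adjoin B z}.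
Proof. by move=> b bB; apply/adjoinP; exists b%:P; rewrite ?polyOverC ?hornerC. Qed.

Lemma adjoin_gen (B : subringClosed K) z : z \in adjoin B z.
Proof. by apply/adjoinP; exists 'X; rewrite ?polyOverX ?hornerX. Qed.

(** Write [s] for [t^-1].  By the last hypothesis on [B] the element [1 - s * q_0]
    has its inverse in [B], so the relation [1 = s * q.[z^-1]] makes [z] a root of a monic
    polynomial over [B] of the degree of [p]; subtracting a multiple of it from
    [p] lowers the degree.  The roles of [z] and [z^-1] are exchanged when [q] has
    the larger degree. *)
Lemma adjoin_both_sides (B : subringClosed K) t :
  t \notin B -> t^-1 \in B ->
  (forall b, b \in B -> (1 - t^-1 * b)^-1 \in B) ->
  forall z (p q : {poly K}), z != 0 -> p \is a polyOver B -> q \is a polyOver B ->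
  t = p.[z] -> t = q.[z^-1] -> False.
Proof.
move=> tB sB invB z p q.
have t0 : t != 0 by apply: contraNneq tB => ->; rewrite rpred0.
move: {2}(size p + size q)%N (leqnn (size p + size q)%N) => k.
elim: k z p q => [|k IH] z p q lek z0 pB qB tp tq.
  move: lek t0; rewrite leqn0 addn_eq0 size_poly_eq0 tp => /andP[/eqP-> _].
  by rewrite horner0 eqxx.
wlog leqp : z p q lek z0 pB qB tp tq / (size q <= size p)%N.
  move=> wl; case: (leqP (size q) (size p)) => [|/ltnW] le.
    exact: (wl z p q).
  by apply: (wl z^-1 q p); rewrite ?invrK ?invr_eq0 1?addnC.
case pn: (size p) => [|[|n]].
- by move/eqP: pn t0; rewrite size_poly_eq0 tp => /eqP->; rewrite horner0 eqxx.
- move: tB; rewrite tp [p]size1_polyC ?pn // hornerC.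
  by rewrite (polyOverP pB).
(* r is the monic polynomial with root z; its degree is padded to that of p *)
set c := t^-1 * (1 - t^-1 * q`_0)^-1.
have cB : c \in B by rewrite rpredM // invB // (polyOverP qB).
pose r : {poly K} := 'X^(n.+1) - c *: \sum_(j < n.+1) q`_j.+1 *: 'X^(n - j).
have rB : r \is a polyOver B.
  rewrite rpredB ?polyOverXn // polyOverZ // rpred_sum // => j _.
  by rewrite polyOverZ ?polyOverXn ?(polyOverP qB).
have rz : r.[z] = 0.
  have tE : t = \sum_(j < n.+2) q`_j * z^-1 ^+ j.
    by rewrite -horner_coef_wide // -pn.
  have sumE : (\sum_(j < n.+1) q`_j.+1 *: 'X^(n - j)).[z] = z ^+ n.+1 * (t - q`_0).
    rewrite horner_sum tE [in RHS]big_ord_recl /= expr0 mulr1 addrC addKr mulr_sumr.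
    apply: eq_bigr => j _; rewrite hornerZ hornerXn mulrCA; congr (_ * _).
    rewrite /bump /= add1n exprVn -[in z ^+ n.+1](@subnK j.+1 n.+1) ?ltnS ?leq_ord //.
    by rewrite subSS exprD mulfK // expf_neq0.
  rewrite /r hornerD hornerN hornerZ hornerXn sumE.
  have d0 : 1 - t^-1 * q`_0 != 0.
    apply: contraNneq tB => /eqP; rewrite subr_eq0 => /eqP e.
    by rewrite -[t]mulr1 e mulVKf // (polyOverP qB).
  have -> : t - q`_0 = t * (1 - t^-1 * q`_0) by rewrite mulrBr mulr1 mulVKf.
  rewrite /c mulrCA (mulrACA t^-1) mulVf // mul1r mulVf // mulr1.
  by rewrite subrr.
pose p' := p - p`_n.+1 *: r.
apply: (IH z p' q) => //.
- rewrite -ltnS; apply: leq_trans lek; rewrite ltn_add2r pn ltnS.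
  apply/leq_sizeP => j lej.
  rewrite /p' /r coefB coefZ coefB coefXn coefZ coef_sum.
  rewrite big1 => [|i _]; last first.
    rewrite coefZ coefXn; case: eqP => [e|]; last by rewrite mulr0.
    by move: lej; rewrite e ltnNge leq_subr.
  rewrite mulr0 subr0; have [->|nj] := eqVneq j n.+1; first by rewrite mulr1 subrr.
  by rewrite mulr0 subr0 nth_default // pn ltn_neqAle eq_sym nj.
- by rewrite rpredB // polyOverZ // (polyOverP pB).
- by rewrite /p' hornerD hornerN hornerZ rz mulr0 subr0.
Qed.

(** A subring maximal among those that contain [A] but not [t] is a valuation
    ring: adjoining an element outside it produces [t], and
    [adjoin_both_sides] forbids this for both [z] and [z^-1]. *)
Lemma exists_valuation_ring_avoiding (A : {pred K}) t :
  subring_closed A -> t^-1 \in A -> t \notin A ->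
  exists V : {pred K}, [/\ subring_closed V,
    forall z, z != 0 -> (z \in V) || (z^-1 \in V), {subset A <= V} & t \notin V].
Proof.
move=> Aring sA tA.
pose P (X : set K) := subring_closed [pred z | `[< X z >]] /\ ~ X t.
have [||M [[Mring Mt] AM maxM]] := @zorn_above K P [set z | z \in A]%classic.
- split; last exact/negP.
  case: Aring => A1 AB AMu; split; first exact/asboolP.
  + by move=> u v /asboolP uA /asboolP vA; apply/asboolP; exact: AB.
  + by move=> u v /asboolP uA /asboolP vA; apply/asboolP; exact: AMu.
- move=> F [X0 FX0] FP Ftot; split; last by move=> [X FX]; case: (FP X FX).
  have both u v : (\bigcup_(X in F) X)%classic u -> (\bigcup_(X in F) X)%classic v ->
      exists X, [/\ F X, X u & X v].
    move=> [X FX Xu] [Y FY Yv].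
    by case: (Ftot X Y FX FY) => XY; [exists Y|exists X]; split=> //; exact: XY.
  split.
  + by apply/asboolP; exists X0 => //; case: (FP X0 FX0) => -[/asboolP].
  + move=> u v /asboolP uF /asboolP vF; have [X [FX Xu Xv]] := both u v uF vF.
    apply/asboolP; exists X => //; apply/asboolP.
    by case: (FP X FX) => -[_ h _] _; apply: h; exact/asboolP.
  + move=> u v /asboolP uF /asboolP vF; have [X [FX Xu Xv]] := both u v uF vF.
    apply/asboolP; exists X => //; apply/asboolP.
    by case: (FP X FX) => -[_ _ h] _; apply: h; exact/asboolP.
set B0 : {pred K} := [pred z | `[< M z >]] in Mring.
pose B : subringClosed K :=
  HB.pack B0 (GRing.isSubringClosed.Build K B0 Mring).
have tB : t \notin B by apply/negP => /asboolP.
have AB z : z \in A -> z \in B by move=> zA; apply/asboolP; exact: AM.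
have sB : t^-1 \in B by exact: AB.
have t0 : t != 0 by apply: contraNneq tB => ->; rewrite rpred0.
have adj z : z \notin B -> exists2 p, p \is a polyOver B & t = p.[z].
  move=> zB; apply: contrapT => nt; move/negP: zB; apply; apply/asboolP.
  apply: (maxM [set v | v \in adjoin B z]%classic); last exact: adjoin_gen.
    split; last by move=> /adjoinP.
    case: (adjoin_closed B z) => h1 h2 h3; split; first exact/asboolP.
    + by move=> u v /asboolP uA /asboolP vA; apply/asboolP; exact: h2.
    + by move=> u v /asboolP uA /asboolP vA; apply/asboolP; exact: h3.
  by move=> v Mv; apply: adjoin_base; exact/asboolP.
have invB b : b \in B -> (1 - t^-1 * b)^-1 \in B.
  move=> bB; set d := 1 - _.
  have dB : d \in B by rewrite rpredB ?rpred1 // rpredM.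
  have [d0|d0] := eqVneq d 0; first by rewrite d0 invr0 rpred0.
  have [//|/adj[p pB tp]] := boolP (d^-1 \in B).
  (* clearing denominators in t = p.[d^-1], the element t^-1 divides a power of
     d = 1 - t^-1 * b in B, hence divides 1 *)
  suff [c cB dE] : exists2 c, c \in B & d ^+ (size p) = t^-1 * c.
    have [e eB dk] : exists2 e, e \in B & d ^+ (size p) = 1 - t^-1 * e.
      elim: (size p) => [|k [e eB IH]].
        by exists 0; rewrite ?rpred0 // mulr0 subr0 expr0.
      exists (b + e * d); first by rewrite rpredD // rpredM.
      by rewrite exprSr IH /d; ring.
    case/negP: tB; have -> : t = c + e.
      apply: (mulfI (invr_neq0 t0)); rewrite mulVf // mulrDr -dE dk.
      by rewrite subrK.
    by rewrite rpredD.
  exists (\sum_(i < size p) p`_i * d ^+ (size p - i)).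
    by rewrite rpred_sum // => i _; rewrite rpredM ?rpredX ?(polyOverP pB).
  have /(congr1 ( *%R (d ^+ size p))) := tp; rewrite horner_coef mulr_sumr => e.
  apply: (mulfI t0); rewrite mulVKf // mulrC e; apply: eq_bigr => i _.
  rewrite mulrCA; congr (_ * _); rewrite exprVn.
  rewrite -[in d ^+ size p](@subnK i (size p)); last exact: ltnW.
  by rewrite exprD mulfK // expf_neq0.
exists B0; split=> //.
move=> z z0; apply/orP; apply: contrapT => /not_orP[/negP zB /negP zVB].
have [p pB tp] := adj z zB; have [q qB tq] := adj _ zVB.
exact: (@adjoin_both_sides B t tB sB invB z p q).
Qed.

End Chevalley.

(** * Noetherian domains and Krull's intersection theorem *)

Section IdealTheory.
Variable A : idomainType.
Implicit Types (J : {pred A}) (g t z : A).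

Lemma is_idealMr J c z : is_ideal J -> z \in J -> c * z \in J.
Proof. by move=> [J0 JD] zJ; rewrite -[_ * _]addr0 JD. Qed.

Lemma is_idealD J u v : is_ideal J -> u \in J -> v \in J -> u + v \in J.
Proof. by move=> [J0 JD] uJ vJ; rewrite -[u]mul1r JD. Qed.

Lemma is_ideal_sum J n (F : 'I_n -> A) :
  is_ideal J -> (forall i, F i \in J) -> \sum_(i < n) F i \in J.
Proof.
move=> hJ FJ; elim/big_rec: _ => [|i z _ zJ]; first by case: hJ.
exact: is_idealD.
Qed.

Lemma noetherian_acc (J : nat -> {pred A}) :
  noetherian A -> (forall n, is_ideal (J n)) ->
  (forall n, {subset J n <= J n.+1}) ->
  exists N, forall n, {subset J n <= J N}.
Proof.
move=> noeA Jid Jinc.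
have Jle n m : (n <= m)%N -> {subset J n <= J m}.
  by move/subnK <-; elim: (m - n)%N => // k IH z /IH /Jinc.
pose U : {pred A} := [pred z | `[< exists n, z \in J n >]].
have Uid : is_ideal U.
  split=> [|c u v /asboolP[n un] /asboolP[m vm]]; apply/asboolP.
    by exists 0%N; case: (Jid 0%N).
  exists (maxn n m); case: (Jid (maxn n m)) => _; apply.
    by apply: Jle un; exact: leq_maxl.
  by apply: Jle vm; exact: leq_maxr.
have [k [g gP]] := noeA U Uid.
have gU i : exists n, g i \in J n.
  apply/asboolP; apply/gP; exists (fun j => (j == i)%:R).
  rewrite (bigD1 i) //= eqxx mul1r big1 ?addr0 // => j /negPf->.
  by rewrite mul0r.
have [h hP] := choice gU.
exists (\max_(i < k) h i) => n z zn.
have /gP[c ->] : z \in U by apply/asboolP; exists n.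
apply: is_ideal_sum => // i; apply: is_idealMr => //.
by apply: Jle (hP i); exact: leq_bigmax.
Qed.

Definition divides g z := exists c, z = c * g.

Definition in_pair g h z := exists a b, z = a * g + b * h.

Lemma in_pair_ideal g h : is_ideal [pred z | `[< in_pair g h z >]].
Proof.
split=> [|c u v /asboolP[a [b ->]] /asboolP[a' [b' ->]]]; apply/asboolP.
  by exists 0, 0; rewrite !mul0r addr0.
by exists (c * a + a'), (c * b + b'); ring.
Qed.

(** Write [z = a k * g + b k * t ^+ k].  The ideals [(g : t ^+ k)] become constant
    at some [k0], so that [e k = t ^+ k0 * b (k0 + k)] is congruent to
    [t * e k.+1] modulo [g].  The ideals [(g, e k)] increase, and once they are
    constant [e N.+1] is a multiple of [t * e N.+1] modulo [g], so a multiple of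
    [g]; descending to [e 0] gives the claim for [z]. *)
Lemma krull_intersection g t z : noetherian A ->
  (forall d, 1 - d * t \is a GRing.unit) ->
  (forall k, in_pair g (t ^+ k) z) -> divides g z.
Proof.
move=> noeA jac /choice[a /choice[b zE]].
pose J k : {pred A} := [pred w | `[< divides g (w * t ^+ k) >]].
have [k|k w /asboolP[c wc]|k0 Jk0] := noetherian_acc (J := J) noeA.
- split=> [|c u v /asboolP[d ud] /asboolP[e ve]]; apply/asboolP.
    by exists 0; rewrite !mul0r.
  by exists (c * d + e); rewrite mulrDl -mulrA ud ve; ring.
- by apply/asboolP; exists (c * t); rewrite exprSr mulrA wc; ring.
have step k : exists c, t ^+ k0 * b (k0 + k)%N =
    t * (t ^+ k0 * b (k0 + k).+1) + c * g.
  have /asboolP[c cE] : b (k0 + k)%N - t * b (k0 + k).+1 \in J k0.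
    apply: (Jk0 (k0 + k)%N); apply/asboolP.
    exists (a (k0 + k).+1 - a (k0 + k)%N).
    set K := (k0 + k)%N.
    have e : a K * g + b K * t ^+ K = a K.+1 * g + b K.+1 * (t * t ^+ K).
      by rewrite -exprS -!zE.
    have -> : (b K - t * b K.+1) * t ^+ K = (a K * g + b K * t ^+ K)
        - (a K * g + b K.+1 * (t * t ^+ K)) by ring.
    by rewrite e; ring.
  exists c; rewrite -cE; ring.
pose e k := t ^+ k0 * b (k0 + k)%N.
have stepe k : exists c, e k = t * e k.+1 + c * g.
  by rewrite /e addnS; exact: step.
have [k|k w /asboolP[p [q ->]]|N LN] :=
    noetherian_acc (J := fun k => [pred w | `[< in_pair g (e k) w >]]) noeA.
- exact: in_pair_ideal.
- have [c ->] := stepe k.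
  by apply/asboolP; exists (p + q * c), (q * t); ring.
have eN : divides g (e N.+1).
  have /asboolP[p [q eE]] : e N.+1 \in [pred w | `[< in_pair g (e N) w >]].
    by apply: (LN N.+1); apply/asboolP; exists 0, 1; ring.
  have [c eN] := stepe N.
  exists ((1 - q * t)^-1 * (p + q * c)).
  apply: (mulrI (jac q)); rewrite -mulrA mulVKr //.
  by rewrite mulrBl mul1r {1}eE eN; ring.
have e0 : divides g (e 0%N).
  elim: (N.+1) eN => // k IH [c ek]; apply: IH.
  by have [d ->] := stepe k; exists (t * c + d); rewrite ek; ring.
have [c e0E] := e0; exists (a k0 + c).
by rewrite (zE k0) mulrDl -e0E /e addn0 mulrC (mulrC (b k0)) [g * _]mulrC.
Qed.

End IdealTheory.

(** * Two-dimensional local domains *)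

(** A form of [regular_local_ring2] that is visibly symmetric in [x] and [y]; the
    prime ideal in the last field is neither zero nor maximal, and stands for
    the dimension being at least two. *)
Record two_dim_local (D : idomainType) (x y : D) : Prop := TwoDimLocal {
  tdl_noetherian : noetherian D;
  tdl_nonunit : forall z, z \isn't a GRing.unit <-> in_pair x y z;
  tdl_prime : exists P : {pred D}, [/\ prime_ideal P,
    exists2 z, z \in P & z != 0 & ~ (x \in P /\ y \in P)] }.

Lemma two_dim_localC (D : idomainType) (x y : D) :
  two_dim_local x y -> two_dim_local y x.
Proof.
case=> noeD nuD [P [Ppr Pz Pxy]]; split=> // [z|].
  by split=> [/nuD[a [b ->]]|[a [b ->]]]; [|apply/nuD];
    exists b, a; rewrite addrC.
by exists P; split=> // -[yP xP]; apply: Pxy.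
Qed.

Lemma exists_maximal_ideal (D : idomainType) (z : D) : z \isn't a GRing.unit ->
  exists2 M : {pred D}, maximal_ideal M & z \in M.
Proof.
move=> zu; pose P (X : set D) := idealr_closed [pred w | `[< X w >]].
have [||M [Mid zM maxM]] := @zorn_above D P [set w | exists c, w = c * z]%classic.
- split=> [||c u v /asboolP[d ->] /asboolP[e ->]].
  + by apply/asboolP; exists 0; rewrite mul0r.
  + apply: contra zu => /asboolP[c e1].
    by apply/unitrP; exists c; rewrite [z * c]mulrC.
  + by apply/asboolP; exists (c * d + e); ring.
- move=> F [X0 FX0] FP Ftot; split.
  + by apply/asboolP; exists X0 => //; case: (FP X0 FX0) => /asboolP.
  + apply/asboolP => -[X FX X1]; case: (FP X FX) => _ /negP[].
    exact/asboolP.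
  + move=> c u v /asboolP[X FX Xu] /asboolP[Y FY Yv].
    have [Z [FZ Zu Zv]] : exists Z, [/\ F Z, Z u & Z v].
      by case: (Ftot X Y FX FY) => XY; [exists Y|exists X]; split=> //; exact: XY.
    apply/asboolP; exists Z => //; apply/asboolP.
    by case: (FP Z FZ) => _ _; apply; exact/asboolP.
pose M0 : {pred D} := [pred w | `[< M w >]].
exists M0; last by apply/asboolP; apply: zM; exists 1; rewrite mul1r.
split=> // J Jid MJ w wJ; apply/asboolP.
apply: (maxM [set w | w \in J]%classic) => //.
- case: Jid => J0 J1 JD; split; first exact/asboolP.
    by apply/asboolP; exact/negP.
  by move=> c u v /asboolP uJ /asboolP vJ; apply/asboolP; exact: JD.
- by move=> v Mv; apply: MJ; exact/asboolP.
Qed.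

Lemma two_dim_local_of_regular (D : idomainType) (x y : D) :
  regular_local_ring2 x y -> two_dim_local x y.
Proof.
case=> noeD [[Q [Qpr Qinc]] _] maxD.
have nuP z : z \isn't a GRing.unit <-> in_pair x y z.
  split=> [/exists_maximal_ideal[M Mmax zM]|zxy].
    by have /maxD/(_ z)[+ _] := Mmax; apply.
  pose M0 : {pred D} := [pred w | `[< in_pair x y w >]].
  have [[M00 M01 M0D] _] : maximal_ideal M0.
    by apply/maxD => w; split=> [/asboolP|wxy]; last exact/asboolP.
  apply/negP => zu; case/negP: M01.
  rewrite -(mulVr zu) -[_ * z]addr0; apply: M0D => //; exact/asboolP.
split=> //; exists (Q 1%N).
have prop i : (i <= 2)%N -> forall z, z \in Q i -> z \isn't a GRing.unit.
  move=> le z zQ; apply/negP => zu; case: (Qpr i le) => -[Q0 /negP Q1 QD] _.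
  by apply: Q1; rewrite -(mulVr zu) -[_ * z]addr0; apply: QD.
split; first exact: Qpr.
  have [_ nQ] := Qinc 0%N isT.
  have [z zQ1 zQ0] : exists2 z, z \in Q 1%N & z \notin Q 0%N.
    apply: contrapT => no; apply: nQ => z z1; apply: contrapT => /negP z0.
    by apply: no; exists z.
  exists z => //; apply: contraNneq zQ0 => ->.
  by case: (Qpr 0%N isT) => -[].
move=> [xQ yQ]; have [_ nQ] := Qinc 1%N isT; apply: nQ => z /(prop 2%N isT).
move=> /nuP[a [b ->]]; case: (Qpr 1%N isT) => -[Q0 _ QD] _.
by apply: (QD a) => //; rewrite -[b * y]addr0; apply: QD.
Qed.

Section LocalTheory.
Variables (D : idomainType) (x y : D).
Hypothesis hD : two_dim_local x y.
Let noeD := tdl_noetherian hD.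
Let nuP := tdl_nonunit hD.
Implicit Types (g z u v w : D).

Lemma nonunit_x : x \isn't a GRing.unit.
Proof. by apply/nuP; exists 1, 0; ring. Qed.

Lemma nonunit_y : y \isn't a GRing.unit.
Proof. by apply/nuP; exists 0, 1; ring. Qed.

Lemma nonunitD u v : u \isn't a GRing.unit -> v \isn't a GRing.unit ->
  u + v \isn't a GRing.unit.
Proof.
move=> /nuP[a [b ->]] /nuP[c [d ->]]; apply/nuP.
by exists (a + c), (b + d); ring.
Qed.

Lemma nonunitM u v : v \isn't a GRing.unit -> u * v \isn't a GRing.unit.
Proof. by move=> /nuP[a [b ->]]; apply/nuP; exists (u * a), (u * b); ring. Qed.

Lemma unit_subM u v w : u \is a GRing.unit -> w \isn't a GRing.unit ->
  u - v * w \is a GRing.unit.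
Proof.
move=> uu wu; apply: contraTT uu => nu.
by rewrite -(subrK (v * w) u); apply: nonunitD => //; exact: nonunitM.
Qed.

Lemma krull_local g t z : t \isn't a GRing.unit ->
  (forall k, in_pair g (t ^+ k) z) -> divides g z.
Proof.
move=> tu; apply: krull_intersection => // d.
by apply: unit_subM; rewrite ?unitr1.
Qed.

(** The exponent [k] is the largest one with [z] in [(g, t ^+ k)]; it exists by
    Krull's intersection theorem. *)
Lemma exact_order g t z : t \isn't a GRing.unit -> ~ divides g z ->
  exists k a b, z = a * g + b * t ^+ k /\ ~ in_pair g t b.
Proof.
move=> tu ngz.
have ex : exists k, ~~ `[< in_pair g (t ^+ k) z >].
  apply: contrapT => no; apply/ngz/(krull_local tu) => k.
  by apply: contrapT => nk; apply: no; exists k; apply/asboolP.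
case: (ex_minnP ex) => -[|k] /asboolP nk mink.
  by case: nk; exists 0, z; rewrite expr0; ring.
have /asboolP[a [b zE]] : `[< in_pair g (t ^+ k) z >].
  by apply: contraT => /mink; rewrite ltnn.
exists k, a, b; split=> // -[c [d bE]]; apply: nk.
by exists (a + c * t ^+ k), d; rewrite zE bE exprS; ring.
Qed.

Lemma expand_mod_x z : ~ divides x z ->
  exists i u w, u \is a GRing.unit /\ z = u * y ^+ i + w * x.
Proof.
move=> /(exact_order nonunit_y)[i [w [u [-> nu]]]].
exists i, u, w; split; last by rewrite addrC.
by apply: contrapT => /negP/nuP.
Qed.

(** A case of Krull's principal ideal theorem.  Suppose that [y ^+ n] is a
    multiple of [x], with [n] minimal, and let [P] be a prime ideal that is
    neither zero nor maximal, so that [x] is not in [P].  Among the elements of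
    [P] that are not multiples of [x], let [p] have the least order [i] in [y]
    modulo [x].  Then [P] is contained in [(p) + x P], and Krull's intersection
    theorem gives [P = (p)].  Now [p * y ^+ (n - i)] is a multiple [v' * x];
    here [v'] lies in [P], and cancelling [p] shows that [x] divides
    [y ^+ (n - i)], against the choice of [n]. *)
Lemma x_ndiv_pow_y n : ~ divides x (y ^+ n).
Proof.
move=> ex; have {n}ex : exists n, `[< divides x (y ^+ n) >] by exists n; apply/asboolP.
case: (ex_minnP ex) => n /asboolP[v yn] minn.
have [P [[[P0 P1 PD] Ppr] [z0 z0P z0n0] nxy]] := tdl_prime hD.
have Pid : is_ideal P by [].
have powP k : y ^+ k \in P -> y \in P.
  elim: k => [|k IH]; first by rewrite (negPf P1).
  by rewrite exprS => /Ppr/orP[|/IH].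
have xP : x \notin P.
  apply/negP => xP; apply: nxy; split=> //; apply: (powP n).
  by rewrite yn is_idealMr.
(* removing the powers of x from an element of P leaves an element of P *)
have strip z : z \in P -> z != 0 ->
    exists2 p, p \in P & ~ divides x p.
  move=> zP zn0.
  have ndv0 : ~ divides 0 z by move=> [c /eqP]; rewrite mulr0; exact/negP.
  have [k [a [p [zE np]]]] := exact_order nonunit_x ndv0.
  rewrite mulr0 add0r in zE; exists p.
    move: zP; rewrite zE => /Ppr/orP[//|]; elim: (k) => [|j IH].
      by rewrite (negPf P1).
    by rewrite exprS => /Ppr/orP[|//]; rewrite (negPf xP).
  by move=> [c pE]; apply: np; exists 0, c; rewrite pE; ring.
have exi : exists i, `[< exists p u w, [/\ p \in P, ~ divides x p,
    u \is a GRing.unit & p = u * y ^+ i + w * x] >].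
  have [p pP np] := strip z0 z0P z0n0.
  have [i [u [w [uu pE]]]] := expand_mod_x np.
  by exists i; apply/asboolP; exists p, u, w.
case: (ex_minnP exi) => i /asboolP[p [u [w [pP np uu pE]]]] mini.
have lt_in : (i < n)%N.
  rewrite ltnNge; apply/negP => /subnKC e; apply: np.
  by exists (u * y ^+ (i - n) * v + w); rewrite pE -[in LHS]e exprD yn; ring.
have i_gt0 : (0 < i)%N.
  rewrite lt0n; apply/eqP => i0; move: pE; rewrite i0 expr0 mulr1 => pE.
  have pu : p \is a GRing.unit.
    by rewrite pE -[w]opprK mulNr; apply: unit_subM nonunit_x.
  by case/negP: P1; rewrite -(mulVr pu) is_idealMr.
have stepP q : q \in P -> exists a q', q' \in P /\ q = a * p + q' * x.
  move=> qP; have [[c qE]|nq] := pselect (divides x q).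
    exists 0, c; split; last by rewrite mul0r add0r.
    by move: qP; rewrite qE => /Ppr/orP[//|]; rewrite (negPf xP).
  have [j [u' [w' [uu' qE]]]] := expand_mod_x nq.
  have leij : (i <= j)%N by apply: mini; apply/asboolP; exists q, u', w'.
  pose a := u' * u^-1 * y ^+ (j - i).
  have e : q = a * p + (w' - a * w) * x.
    rewrite qE pE -[in y ^+ j](subnK leij) exprD /a.
    by rewrite -[u' in LHS](mulrVK uu); ring.
  clearbody a; exists a, (w' - a * w); split=> //.
  have : (w' - a * w) * x \in P.
    have -> : (w' - a * w) * x = q + (- a) * p by rewrite {1}e; ring.
    by apply: is_idealD => //; exact: is_idealMr.
  by move/Ppr/orP => [//|]; rewrite (negPf xP).
have genP z : z \in P -> divides p z.
  move=> zP; apply: (krull_local nonunit_x) => k.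
  suff [a [b [_ ->]]] : exists a b, b \in P /\ z = a * p + b * x ^+ k.
    by exists a, b.
  elim: k => [|k [a [b [bP ->]]]]; first by exists 0, z; split=> //; ring.
  have [c [q [qP ->]]] := stepP b bP.
  by exists (a + c * x ^+ k), q; split=> //; rewrite exprS; ring.
pose v' := u * v + w * y ^+ (n - i).
have pyE : p * y ^+ (n - i) = v' * x.
  rewrite pE mulrDl -mulrA -exprD subnKC 1?ltnW // yn /v'; ring.
have v'P : v' \in P.
  have : v' * x \in P by rewrite -pyE mulrC is_idealMr.
  by move/Ppr/orP => [//|]; rewrite (negPf xP).
have [v2 v2E] := genP v' v'P.
have pn0 : p != 0 by apply/eqP => p0; apply: np; exists 0; rewrite p0 mul0r.
have : divides x (y ^+ (n - i)).
  exists v2; apply: (mulfI pn0); rewrite pyE v2E; ring.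
move/asboolP/minn; rewrite leqNgt => /negP; apply.
by rewrite ltn_subrL i_gt0 (leq_ltn_trans _ lt_in).
Qed.

(** Modulo [x] every nonzero element is a unit times a power of [y], and no power
    of [y] vanishes. *)
Lemma x_prime u v : divides x (u * v) -> divides x u \/ divides x v.
Proof.
move=> [c uvE]; apply: contrapT => /not_orP[].
move=> /expand_mod_x[i [u1 [w1 [uu1 uE]]]] /expand_mod_x[j [u2 [w2 [uu2 vE]]]].
apply: (@x_ndiv_pow_y (i + j)).
exists (u1^-1 * u2^-1 * (c - u1 * y ^+ i * w2 - w1 * (u2 * y ^+ j + w2 * x))).
have uu12 : u1 * u2 \is a GRing.unit by rewrite unitrM uu1.
apply: (mulrI uu12); rewrite exprD.
have -> : u1 * u2 * (y ^+ i * y ^+ j) = u * v - u1 * y ^+ i * w2 * x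
   - w1 * (u2 * y ^+ j + w2 * x) * x by rewrite uE vE; ring.
rewrite uvE -(mulrA (u1^-1 * u2^-1)) -invrM // [u2 * u1]mulrC mulVKr //.
ring.
Qed.

End LocalTheory.

(** * Monomials and monomial representations *)

Section Monomials.
Variables (D : idomainType) (x y : D).
Hypothesis hD : two_dim_local x y.
Implicit Types (e f : nat * nat) (s : seq (D * (nat * nat))).
Local Notation mono := (monomial x y).

Lemma x_neq0 : x != 0.
Proof.
apply/eqP => x0; apply: (x_ndiv_pow_y (two_dim_localC hD) (n := 1)).
by exists 0; rewrite x0 expr1 mul0r.
Qed.

Lemma monomialM e f : mono (e.1 + f.1, e.2 + f.2)%N = mono e * mono f.
Proof. by rewrite /monomial /= !exprD; ring. Qed.

Lemma pow_x_dvd p q b : divides (x ^+ p) (b * y ^+ q) -> divides (x ^+ p) b.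
Proof.
elim: p b => [|p IH] b; first by move=> _; exists b; rewrite mulr1.
move=> [c bE].
have [|[b' b'E]|] := x_prime hD (u := b) (v := y ^+ q).
- by exists (c * x ^+ p); rewrite bE exprSr; ring.
- have [|d dE] := IH b'.
    exists c; apply: (mulIf x_neq0).
    by rewrite -mulrA [_ * x]mulrC mulrA -b'E bE exprSr; ring.
  by exists d; rewrite b'E dE exprSr; ring.
- by move/(x_ndiv_pow_y hD).
Qed.

(** Dividing by [x ^+ p] turns such a relation into one that puts
    [(1 - d * y) * y ^+ q] in the ideal [(x)]. *)
Lemma monomial_notin p q : ~ in_pair (x ^+ p.+1) (y ^+ q.+1) (mono (p, q)).
Proof.
move=> [a [b]]; rewrite /monomial /= => e.
have [|d bE] := @pow_x_dvd p q.+1 b.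
  exists (y ^+ q - a * x); rewrite mulrBl -(mulrA a) -exprS [_ * x ^+ p]mulrC e.
  by ring.
have xn0 : x ^+ p != 0 by rewrite expf_neq0 // x_neq0.
have du : 1 - d * y \is a GRing.unit.
  by apply: (unit_subM hD); rewrite ?unitr1 ?(nonunit_y hD).
apply: (x_ndiv_pow_y hD (n := q)); exists ((1 - d * y)^-1 * a).
apply: (mulrI du); rewrite -mulrA mulVKr //; apply: (mulfI xn0).
have -> : x ^+ p * ((1 - d * y) * y ^+ q)
    = x ^+ p * y ^+ q - d * x ^+ p * y ^+ q.+1 by rewrite exprS; ring.
by rewrite e bE exprS; ring.
Qed.

Lemma monomial_dvd e f d : mono f = d * mono e -> (e.1 <= f.1)%N && (e.2 <= f.2)%N.
Proof.
case: e f => [p q] [p' q'] /= e.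
rewrite (leqNgt p) (leqNgt q) -negb_or; apply/negP => /orP[lt|lt];
  apply: (@monomial_notin p' q'); rewrite e.
  exists (d * x ^+ (p - p'.+1) * y ^+ q), 0.
  by rewrite /monomial /= -[in LHS](subnK lt) exprD; ring.
exists 0, (d * x ^+ p * y ^+ (q - q'.+1)).
by rewrite /monomial /= -[in LHS](subnK lt) exprD; ring.
Qed.

(** Exponents listed with increasing power of [x] and decreasing power of [y];
    their monomials do not divide each other. *)
Definition staircase s :=
  pairwise (fun t t' => (t.2.1 < t'.2.1) && (t'.2.2 < t.2.2))%N s.

Definition shift_x k (t : D * (nat * nat)) := (t.1, (k + t.2.1, t.2.2)%N).

Lemma sum_shift_x k s :
  \sum_(t <- map (shift_x k) s) t.1 * mono t.2
    = (\sum_(t <- s) t.1 * mono t.2) * x ^+ k.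
Proof.
rewrite big_map mulr_suml; apply: eq_bigr => t _.
by rewrite /monomial /= exprD; ring.
Qed.

Lemma staircase_shift_x k s : staircase (map (shift_x k) s) = staircase s.
Proof.
by rewrite /staircase pairwise_map; apply: eq_pairwise => t t' /=; rewrite ltn_add2l.
Qed.

(** By induction on [i]: if [z] is not a multiple of [y ^+ i], let [k] be maximal
    with [z = a * y ^+ i + b * x ^+ k]; then [a] is a unit, [k > 0], and the order
    of [b] in [y] modulo [x] is less than [i]. *)
Lemma staircase_exists i u w : u \is a GRing.unit -> exists s,
  [/\ u * y ^+ i + w * x = \sum_(t <- s) t.1 * mono t.2,
      all (fun t => t.1 \is a GRing.unit) s,
      all (fun t => t.2.2 <= i)%N s & staircase s].
Proof.
elim/ltn_ind: i u w => i IH u w uu; set z := _ + _.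
have coefu v c : z = v * y ^+ i + c * x -> v \is a GRing.unit.
  move=> zE; apply: contrapT => /negP/(tdl_nonunit hD)[a [b vE]].
  have ubu : u - b * y \is a GRing.unit by apply: (unit_subM hD); rewrite ?(nonunit_y hD).
  apply: (x_ndiv_pow_y hD (n := i)).
  exists ((u - b * y)^-1 * (a * y ^+ i + c - w)).
  apply: (mulrI ubu); rewrite -mulrA mulVKr //.
  have -> : (u - b * y) * y ^+ i = z - w * x - b * y * y ^+ i by rewrite /z; ring.
  by rewrite zE vE; ring.
have [[v zE]|nz] := pselect (divides (y ^+ i) z).
  exists [:: (v, (0, i)%N)]; rewrite big_seq1 /staircase /= leqnn /monomial expr0 mul1r.
  by split=> //; rewrite andbT (coefu v 0) // zE; ring.
have [k [a [b [zE nb]]]] := exact_order hD (nonunit_x hD) nz.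
case: k zE => [|k] zE.
  case: nb; exists (u - a), w; apply: (addrI (a * y ^+ i)).
  by rewrite -[b]mulr1 -zE /z; ring.
have ua : a \is a GRing.unit.
  by apply: (coefu a (b * x ^+ k)); rewrite zE exprSr; ring.
have [|j [u' [w' [uu' bE]]]] := @expand_mod_x _ _ _ hD b.
  by move=> [c bE]; apply: nb; exists 0, c; rewrite bE; ring.
have ltji : (j < i)%N.
  rewrite ltnNge; apply/negP => /subnK leij; apply: nb.
  by exists (u' * y ^+ (j - i)), w'; rewrite bE -[in LHS]leij exprD; ring.
have [s [sE su sj ss]] := IH j ltji u' w' uu'.
exists ((a, (0, i)%N) :: map (shift_x k.+1) s); split.
- by rewrite big_cons sum_shift_x -sE -bE zE /monomial /= expr0 mul1r.
- by rewrite /= ua all_map.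
- rewrite /= leqnn all_map; apply: sub_all sj => t /= /leq_trans; apply.
  exact: ltnW.
- have := staircase_shift_x k.+1 s; rewrite ss /staircase /= => ->.
  rewrite andbT all_map; apply: sub_all sj => t /= letj.
  exact: leq_ltn_trans ltji.
Qed.

Lemma monomial_rep_exists z : z != 0 -> exists s, monomial_rep x y z s.
Proof.
move=> zn0.
have nz : ~ divides 0 z by move=> [c /eqP]; rewrite mulr0; exact/negP.
have [k [a [b [zE nb]]]] := exact_order hD (nonunit_x hD) nz.
have [|j [u' [w' [uu' bE]]]] := @expand_mod_x _ _ _ hD b.
  by move=> [c bE]; apply: nb; exists 0, c; rewrite bE; ring.
have [s [sE su _ ss]] := staircase_exists j w' uu'.
exists (map (shift_x k) s); split.
- by rewrite sum_shift_x -sE -bE zE mulr0 add0r.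
- by move=> t /mapP[t' /(allP su) ut' ->].
move=> i i' lti lti' neq tau [d /monomial_dvd].
rewrite -(staircase_shift_x k) in ss; move: ss lti lti' {sE su} => /pairwiseP ss lti lti'.
have := ss (0, (0, 0)%N) i i' lti lti'; have := ss (0, (0, 0)%N) i' i lti' lti.
case: (ltngtP i i') neq => // _ _ /= h h'.
  by move: (h' isT) => /andP[_]; rewrite ltnNge => /negPf->; rewrite andbF.
by move: (h isT) => /andP[+ _]; rewrite ltnNge => /negPf->.
Qed.

End Monomials.

(** * Leading exponents *)

Section LeadingExponent.
Variables (D : idomainType) (R : realType) (x y : D).
Hypothesis hD : two_dim_local x y.
Variable r : R.
Hypothesis r_gt0 : 0 < r.
Implicit Types (e f : nat * nat) (z h : D).
Local Notation mono := (monomial x y).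
Local Notation W := (monomial_weight r).
Local Notation add e f := (e.1 + f.1, e.2 + f.2)%N.

(** The order on exponents by weight, with ties broken by the exponent of [x];
    for positive [r] it is total, so that a product has a single leading term. *)
Definition exp_lt e f := (W e < W f) || (W e == W f) && (e.1 < f.1)%N.

Lemma weight_add e f : W (add e f) = W e + W f.
Proof. by rewrite /monomial_weight /= !natrD; ring. Qed.

Lemma exp_lt_total e f : e != f -> exp_lt e f || exp_lt f e.
Proof.
move=> nef; rewrite /exp_lt; case: (ltgtP (W e) (W f)) => //= ew.
case: (ltngtP e.1 f.1) => // e1; case/eqP: nef.
rewrite [e]surjective_pairing [f]surjective_pairing e1; congr pair.
move: ew; rewrite /monomial_weight e1 => /addrI/(mulIf (lt0r_neq0 r_gt0))/eqP.
by rewrite eqr_nat => /eqP.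
Qed.

Lemma exp_lt_trans e f g : exp_lt e f -> exp_lt f g -> exp_lt e g.
Proof.
rewrite /exp_lt => /orP[ef|/andP[/eqP-> ef]] /orP[fg|/andP[/eqP<- fg]].
- by rewrite (lt_trans ef fg).
- by rewrite ef.
- by rewrite fg.
- by rewrite eqxx (ltn_trans ef fg) orbT.
Qed.

Lemma exp_lt_addl e f g : exp_lt f g -> exp_lt (add e f) (add e g).
Proof.
by rewrite /exp_lt !weight_add ltrD2l (inj_eq (addrI _)) /= ltn_add2l.
Qed.

Lemma exp_lt_weight e f : exp_lt e f -> W e <= W f.
Proof. by case/orP => [/ltW//|/andP[/eqP->]]. Qed.

(** Membership in the ideal generated by the monomials with exponent above [e]. *)
Definition higher e h := exists2 s : seq (D * (nat * nat)),
  all (fun t => exp_lt e t.2) s & h = \sum_(t <- s) t.1 * mono t.2.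

Lemma higher0 e : higher e 0.
Proof. by exists [::]; rewrite ?big_nil. Qed.

Lemma higherD e h h' : higher e h -> higher e h' -> higher e (h + h').
Proof.
move=> [s hs ->] [s' hs' ->]; exists (s ++ s'); last by rewrite big_cat.
by rewrite all_cat hs hs'.
Qed.

Lemma higherM e c h : higher e h -> higher e (c * h).
Proof.
move=> [s hs ->]; exists [seq (c * t.1, t.2) | t <- s]; first by rewrite all_map.
by rewrite big_map mulr_sumr; apply: eq_bigr => t _; rewrite mulrA.
Qed.

Lemma higher_mono e f : exp_lt e f -> higher e (mono f).
Proof.
by move=> ef; exists [:: (1, f)]; rewrite ?big_seq1 ?mul1r //= ef.
Qed.

Lemma higher_trans e f h : exp_lt e f -> higher f h -> higher e h.
Proof.
move=> ef [s hs ->]; exists s => //.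
by apply: sub_all hs => t; exact: exp_lt_trans.
Qed.

Lemma higher_shift e f h : higher f h -> higher (add e f) (mono e * h).
Proof.
move=> [s hs ->]; exists [seq (t.1, add e t.2) | t <- s].
  by rewrite all_map; apply: sub_all hs => t /=; exact: exp_lt_addl.
rewrite big_map mulr_sumr; apply: eq_bigr => t _.
by rewrite /= monomialM; ring.
Qed.

(** An exponent above [e] is not componentwise at most [e]. *)
Lemma higher_in_pair e h : higher e h -> in_pair (x ^+ e.1.+1) (y ^+ e.2.+1) h.
Proof.
move=> [s + ->]; elim: s => [_|[c f] s IH /= /andP[ef /IH[a [b sE]]]].
  by exists 0, 0; rewrite big_nil; ring.
rewrite big_cons sE /=.
case: (ltnP e.1 f.1) => [lt|le1].
  exists (a + c * x ^+ (f.1 - e.1.+1) * y ^+ f.2), b.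
  by rewrite /monomial -[in LHS](subnK lt) exprD; ring.
case: (ltnP e.2 f.2) => [lt|le2].
  exists a, (b + c * x ^+ f.1 * y ^+ (f.2 - e.2.+1)).
  by rewrite /monomial -[in LHS](subnK lt) exprD; ring.
have leW : W f <= W e.
  by rewrite /monomial_weight lerD ?ler_nat // ler_wpM2r ?ler_nat // ltW.
by move: ef; rewrite /exp_lt ltNge leW /= ltnNge le1 andbF.
Qed.

Lemma unit_monomial_not_higher e u : u \is a GRing.unit -> ~ higher e (u * mono e).
Proof.
move=> uu /(higherM u^-1); rewrite mulKr // => /higher_in_pair.
by rewrite [e]surjective_pairing; exact: monomial_notin.
Qed.

Definition lead z e := exists u h,
  [/\ u \is a GRing.unit, higher e h & z = u * mono e + h].

Lemma lead_higher e f z : exp_lt e f -> lead z f -> higher e z.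
Proof.
move=> ef [u [h [_ hh ->]]]; apply: higherD; last exact: higher_trans hh.
by apply: higherM; exact: higher_mono.
Qed.

Lemma lead_not_higher e z : lead z e -> ~ higher e z.
Proof.
move=> [u [h [uu hh zE]]] hz; apply: (unit_monomial_not_higher (e := e) uu).
have -> : u * mono e = z + (-1) * h by rewrite zE; ring.
by apply: higherD => //; exact: higherM.
Qed.

Lemma lead_unique z e f : lead z e -> lead z f -> e = f.
Proof.
move=> le lf; apply/eqP; apply: contraT => /exp_lt_total/orP[ef|fe].
  by case: (lead_not_higher le); exact: lead_higher lf.
by case: (lead_not_higher lf); exact: lead_higher le.
Qed.

Lemma leadM z z' e f : lead z e -> lead z' f -> lead (z * z') (add e f).
Proof.
move=> [u [h [uu hh ->]]] [v [k [vu hk ->]]].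
exists (u * v), (u * (mono e * k) + v * (mono f * h) + h * k); split.
- by rewrite unitrM uu.
- apply: higherD; [apply: higherD; apply: higherM|].
  + exact: higher_shift.
  + by rewrite [(e.1 + _)%N]addnC [(e.2 + _)%N]addnC; exact: higher_shift.
  + move: hh => [s hs ->]; rewrite mulr_suml; elim: s hs => [_|[c g] s IH /=].
      by rewrite big_nil; exact: higher0.
    move=> /andP[eg /IH hs]; rewrite big_cons /=; apply: higherD => //.
    rewrite -mulrA; apply: higherM; apply: higher_trans (higher_shift g hk).
    rewrite [(e.1 + _)%N]addnC [(e.2 + _)%N]addnC.
    by rewrite [(g.1 + _)%N]addnC [(g.2 + _)%N]addnC; exact: exp_lt_addl.
by rewrite monomialM; ring.
Qed.

(** Were [W g < c], both summands would lie in the ideal of monomials above [g]. *)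
Lemma lead_add_weight z z' e f g c : lead z e -> lead z' f -> lead (z + z') g ->
  c <= W e -> c <= W f -> c <= W g.
Proof.
move=> lz lz' l ce cf; rewrite leNgt; apply/negP => gc.
apply: (lead_not_higher l); apply: higherD.
  by apply: lead_higher lz; rewrite /exp_lt (lt_le_trans gc ce).
by apply: lead_higher lz'; rewrite /exp_lt (lt_le_trans gc cf).
Qed.

Lemma lead_monomial_unit u e : u \is a GRing.unit -> lead (u * mono e) e.
Proof. by move=> uu; exists u, 0; rewrite addr0; split=> //; exact: higher0. Qed.

Lemma least_exponent (s : seq (D * (nat * nat))) : s != [::] ->
  exists2 t, t \in s & forall t', t' \in s -> t'.2 = t.2 \/ exp_lt t.2 t'.2.
Proof.
elim: s => // t s IH _; have [->|/IH[m ms mmin]] := eqVneq s [::].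
  by exists t => [|t']; rewrite inE // => /eqP->; left.
have [e|nmt] := eqVneq m.2 t.2.
  exists t => [|t']; first by rewrite inE eqxx.
  by rewrite inE => /orP[/eqP->|/mmin]; [left|rewrite e].
have /orP[mt|tm] := exp_lt_total nmt.
  exists m => [|t']; first by rewrite inE ms orbT.
  by rewrite inE => /orP[/eqP->|/mmin]; [right|].
exists t => [|t']; first by rewrite inE eqxx.
rewrite inE => /orP[/eqP->|/mmin[->|]]; [by left|by right|right].
exact: exp_lt_trans tm _.
Qed.

(** The leading exponent is the least exponent of the representation; the
    other terms are strictly above it as no monomial is listed twice. *)
Lemma monomial_rep_lead z s : z != 0 -> monomial_rep x y z s ->
  exists e, [/\ lead z e, e \in [seq t.2 | t <- s] &
                forall f, f \in [seq t.2 | t <- s] -> W e <= W f].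
Proof.
move=> zn0 [zE su anti].
have [|t ts tmin] := @least_exponent s.
  by apply: contraNneq zn0 => s0; rewrite zE s0 big_nil.
exists t.2; split; [|exact: map_f|]; last first.
  by move=> _ /mapP[t' /tmin + ->] => -[->|/exp_lt_weight].
pose d0 : D * (nat * nat) := (0, (0, 0)%N).
have lti : (index t s < size s)%N by rewrite index_mem.
exists t.1, (\sum_(i < size s | i != Ordinal lti) (nth d0 s i).1 * mono (nth d0 s i).2).
split; [exact: su| |]; last first.
  by rewrite zE (big_nth d0) big_mkord (bigD1 (Ordinal lti)) //= nth_index.
elim/big_rec: _ => [|i h ni hh]; first exact: higher0.
apply: higherD => //; apply: higherM; apply: higher_mono.
case: (tmin _ (mem_nth d0 (ltn_ord i))) => // e.
case: (anti _ _ lti (ltn_ord i)); first by rewrite eq_sym.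
by exists 1; rewrite mul1r -/d0 nth_index // e.
Qed.

Lemma monomial_val_D_lead z e : z != 0 -> lead z e ->
  monomial_val_D x y r z = (W e)%:E.
Proof.
move=> zn0 lz; rewrite /monomial_val_D (negPf zn0).
case: xgetP => [s _ hs|/= no]; last first.
  by have [s /no] := monomial_rep_exists hD zn0.
have [f [lf /mapP[t ts fE] minf]] := monomial_rep_lead zn0 hs.
rewrite (lead_unique lz lf); apply/le_anti/andP; split.
  by rewrite fE; exact: (@ge_bigmin_seq _ _ _ _ _ t xpredT (fun t => (W t.2)%:E)).
rewrite big_seq; apply: le_bigmin; first exact: leey.
by move=> t' /(map_f snd) /minf; rewrite lee_fin.
Qed.

End LeadingExponent.

(** * The monomial valuations on the ring and on its quotient field *)

Section ValuationOnD.
Variables (D : idomainType) (R : realType) (x y : D).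
Hypothesis hD : two_dim_local x y.
Implicit Types (r c : R) (z w : D).
Local Notation W := (monomial_weight (R := R)).

Definition valD r z : R := fine (monomial_val_D x y r z).

Lemma valD_lead r z e : 0 < r -> z != 0 -> lead x y r z e -> valD r z = W r e.
Proof. by move=> r0 zn0 lz; rewrite /valD (monomial_val_D_lead hD r0 zn0 lz). Qed.

Lemma lead_exists r z : 0 < r -> z != 0 -> exists e, lead x y r z e.
Proof.
move=> r0 zn0; have [s hs] := monomial_rep_exists hD zn0.
by have [e [le _ _]] := monomial_rep_lead r0 zn0 hs; exists e.
Qed.

Lemma monomial_val_D_fin r z : 0 < r -> z != 0 ->
  monomial_val_D x y r z = (valD r z)%:E.
Proof.
move=> r0 zn0; have [e le] := lead_exists r0 zn0.
by rewrite (valD_lead r0 zn0 le) (monomial_val_D_lead hD r0 zn0 le).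
Qed.

Lemma valDM r z w : 0 < r -> z != 0 -> w != 0 ->
  valD r (z * w) = valD r z + valD r w.
Proof.
move=> r0 zn0 wn0; have [e le] := lead_exists r0 zn0.
have [f lf] := lead_exists r0 wn0.
rewrite (valD_lead r0 zn0 le) (valD_lead r0 wn0 lf).
by rewrite (valD_lead r0 _ (leadM le lf)) ?mulf_neq0 // weight_add.
Qed.

Lemma valD_add r z w c : 0 < r -> z != 0 -> w != 0 -> z + w != 0 ->
  c <= valD r z -> c <= valD r w -> c <= valD r (z + w).
Proof.
move=> r0 zn0 wn0 zwn0; have [e le] := lead_exists r0 zn0.
have [f lf] := lead_exists r0 wn0; have [g lg] := lead_exists r0 zwn0.
rewrite (valD_lead r0 zn0 le) (valD_lead r0 wn0 lf) (valD_lead r0 zwn0 lg).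
exact: (lead_add_weight hD r0 le lf lg).
Qed.

Lemma valD_ge0 r z : 0 < r -> z != 0 -> 0 <= valD r z.
Proof.
move=> r0 zn0; have [e le] := lead_exists r0 zn0.
by rewrite (valD_lead r0 zn0 le) addr_ge0 ?mulr_ge0 ?ler0n // ltW.
Qed.

Lemma valD_unit r u : 0 < r -> u \is a GRing.unit -> valD r u = 0.
Proof.
move=> r0 uu; have un0 : u != 0 by apply: contraTneq uu => ->; rewrite unitr0.
have := lead_monomial_unit x y r (0, 0)%N uu.
rewrite /monomial mulr1 mulr1 => /(valD_lead r0 un0)->.
by rewrite /monomial_weight mul0r addr0.
Qed.

Lemma valD_nonunit r z : 0 < r -> z != 0 -> z \isn't a GRing.unit -> 0 < valD r z.
Proof.
move=> r0 zn0 zu; have [[p q] le] := lead_exists r0 zn0.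
rewrite (valD_lead r0 zn0 le) /monomial_weight /=.
have [q0|qn0] := posnP q; last first.
  by rewrite ltr_wpDl ?ler0n // mulr_gt0 // ltr0n.
have [p0|pn0] := posnP p; last by rewrite ltr_pwDl ?ltr0n // mulr_ge0 ?ler0n // ltW.
rewrite p0 q0 in le; have [u [h [uu /(higher_in_pair r0)[a [b hE]] zE]]] := le.
have hu : - h \isn't a GRing.unit.
  by apply/(tdl_nonunit hD); exists (-a), (-b); rewrite hE; ring.
suff : u \isn't a GRing.unit by rewrite uu.
have -> : u = z + - h by rewrite zE /monomial; ring.
exact: (nonunitD hD).
Qed.

(** One representation of [z] serves all [r]; its exponents of [y] bound the
    slopes. *)
Lemma valD_lipschitz z : z != 0 -> exists2 C, 0 <= C &
  forall r s, 0 < r -> 0 < s -> valD s z <= valD r z + C * `|s - r|.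
Proof.
move=> zn0; have [l hl] := monomial_rep_exists hD zn0.
exists (\sum_(t <- l) t.2.2%:R) => [|r s r0 s0].
  by apply: sumr_ge0 => t _; exact: ler0n.
have [e [le el _]] := monomial_rep_lead r0 zn0 hl.
have [f [lf fl minf]] := monomial_rep_lead s0 zn0 hl.
rewrite (valD_lead r0 zn0 le) (valD_lead s0 zn0 lf).
apply: le_trans (minf e el) _.
rewrite /monomial_weight -addrA lerD2l -lerBlDl -mulrBr.
apply: le_trans (ler_wpM2l (ler0n _ _) (ler_norm _)) _.
apply: ler_wpM2r; first exact: normr_ge0.
move: el => /mapP[t tl ->]; rewrite (big_rem t tl) /= lerDl.
by apply: sumr_ge0 => ? _; exact: ler0n.
Qed.

(** The denominator of [q] clears the weights [m + n * q]. *)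
Lemma valD_rational (q : rat) z : 0 < ratr q :> R -> z != 0 ->
  exists n : nat, valD (ratr q) z * (denq q)%:~R = n%:R.
Proof.
move=> q0 zn0; have [[m n] le] := lead_exists q0 zn0.
rewrite (valD_lead q0 zn0 le) /monomial_weight /=.
have dn0 : (denq q)%:~R != 0 :> R by rewrite intr_eq0 denq_neq0.
have qE : ratr q * (denq q)%:~R = (numq q)%:~R :> R by rewrite /ratr mulfVK.
have nq : (numq q)%:~R = `|numq q|%N%:R :> R.
  rewrite natr_absz gtr0_norm // -(ltr0z R) -qE.
  by rewrite mulr_gt0 // ltr0z denq_gt0.
exists (m * `|denq q| + n * `|numq q|)%N.
rewrite mulrDl -mulrA qE nq natrD !natrM; congr (_ * _ + _).
by rewrite natr_absz gtr0_norm // denq_gt0.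
Qed.

End ValuationOnD.

Section ValuationOnK.
Variables (D : idomainType) (R : realType) (x y : D).
Hypothesis hD : two_dim_local x y.
Local Notation K := {fraction D}.
Local Notation "d %:F" := (@FracField.tofrac D d).
Implicit Types (r c : R) (z w : K) (d : D).

Definition frac_val r z : R := valD x y r \n_(repr z) - valD x y r \d_(repr z).
Local Notation val := frac_val.

Lemma frac_numden z : z = (\n_(repr z))%:F / (\d_(repr z))%:F.
Proof.
apply: (mulIf (x := (\d_(repr z))%:F)); first by rewrite tofrac_eq0 denom_ratioP.
rewrite mulfVK ?tofrac_eq0 ?denom_ratioP //; set f := repr z.
have -> : z = \pi_({fraction D})%qT f by rewrite reprK.
unlock FracField.tofrac; rewrite -[LHS]FracField.pi_mul; apply/eqmodP.
rewrite /= FracField.equivfE !numden_Ratio ?mulf_neq0 ?oner_eq0 ?denom_ratioP //.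
by apply/eqP; ring.
Qed.

Lemma numer_eq0 z : (\n_(repr z) == 0) = (z == 0).
Proof.
rewrite [in RHS](frac_numden z) mulf_eq0 invr_eq0 !tofrac_eq0.
by rewrite (negPf (denom_ratioP _)) orbF.
Qed.

Lemma val_frac r d1 d2 : 0 < r -> d1 != 0 -> d2 != 0 ->
  val r (d1%:F / d2%:F) = valD x y r d1 - valD x y r d2.
Proof.
move=> r0 d1n d2n; set z := _ / _.
have zn0 : z != 0 by rewrite mulf_neq0 ?invr_eq0 ?tofrac_eq0.
have nn : \n_(repr z) != 0 by rewrite numer_eq0.
have dn := denom_ratioP (repr z).
have : \n_(repr z) * d2 = d1 * \d_(repr z).
  apply/eqP; rewrite -tofrac_eq !tofracM; apply/eqP.
  have := frac_numden z; rewrite {1}/z => /eqP.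
  by rewrite eqr_div ?tofrac_eq0 // => /eqP->.
move/(congr1 (valD x y r)); rewrite !(valDM hD) // /frac_val => e.
lra.
Qed.

Lemma val_tofrac r d : 0 < r -> d != 0 -> val r d%:F = valD x y r d.
Proof.
move=> r0 dn0; rewrite -[d%:F]divr1 -tofrac1 val_frac ?oner_eq0 //.
by rewrite (valD_unit hD r0 (unitr1 _)) subr0.
Qed.

Lemma valM r z w : 0 < r -> z != 0 -> w != 0 -> val r (z * w) = val r z + val r w.
Proof.
move=> r0 zn0 wn0.
have := frac_numden z; have := frac_numden w.
have := denom_ratioP (repr z); have := denom_ratioP (repr w).
move: zn0 wn0; rewrite -2!numer_eq0 /(frac_val r z) /(frac_val r w).
move: (\n_(repr z)) (\d_(repr z)) (\n_(repr w)) (\d_(repr w)).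
move=> n d n' d' nn nn' dn' dn -> ->.
by rewrite mulf_div -!tofracM val_frac ?mulf_neq0 // !(valDM hD) //; ring.
Qed.

Lemma val1 r : 0 < r -> val r 1 = 0.
Proof. by move=> r0; rewrite -tofrac1 val_tofrac ?oner_eq0 // (valD_unit hD r0 (unitr1 _)). Qed.

Lemma valV r z : 0 < r -> z != 0 -> val r z^-1 = - val r z.
Proof.
move=> r0 zn0; apply/eqP; rewrite -addr_eq0 -valM ?invr_eq0 //.
by rewrite mulVf // val1.
Qed.

Lemma valX r z n : 0 < r -> z != 0 -> val r (z ^+ n) = val r z *+ n.
Proof.
move=> r0 zn0; elim: n => [|n IH]; first by rewrite expr0 mulr0n val1.
by rewrite exprS valM ?expf_neq0 // IH mulrS.
Qed.

Lemma valN r z : 0 < r -> z != 0 -> val r (- z) = val r z.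
Proof.
move=> r0 zn0; rewrite -mulN1r valM ?oppr_eq0 ?oner_eq0 //.
rewrite -tofrac1 -tofracN val_tofrac ?oppr_eq0 ?oner_eq0 //.
by rewrite (valD_unit hD r0) ?add0r // unitrN unitr1.
Qed.

Lemma val_add r z w c : 0 < r -> z != 0 -> w != 0 -> z + w != 0 ->
  c <= val r z -> c <= val r w -> c <= val r (z + w).
Proof.
move=> r0 zn0 wn0.
have := frac_numden z; have := frac_numden w.
have := denom_ratioP (repr z); have := denom_ratioP (repr w).
move: zn0 wn0; rewrite -2!numer_eq0 /(frac_val r z) /(frac_val r w).
move: (\n_(repr z)) (\d_(repr z)) (\n_(repr w)) (\d_(repr w)).
move=> n d n' d' nn nn' dn' dn -> ->.
rewrite addf_div ?tofrac_eq0 // -!tofracM -tofracD => sn0 cz cw.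
have sn : n * d' + n' * d != 0.
  by apply: contraNneq sn0 => ->; rewrite tofrac0 mul0r eqxx.
rewrite val_frac ?mulf_neq0 // lerBrDr; apply: (valD_add hD) => //.
- by rewrite mulf_neq0.
- by rewrite mulf_neq0.
- by rewrite !(valDM hD) //; lra.
- by rewrite !(valDM hD) //; lra.
Qed.

Lemma monomial_valringE r z : 0 < r ->
  (z \in monomial_valring x y r) = (z == 0) || (0 <= val r z).
Proof.
move=> r0; rewrite inE /monomial_val.
rewrite (monomial_val_D_fin hD r0 (denom_ratioP _)).
have [->|zn0] := eqVneq z 0.
  have /eqP-> : \n_(repr (0 : K)) == 0 by rewrite numer_eq0.
  by rewrite /monomial_val_D !eqxx addye // leey.
have nn : \n_(repr z) != 0 by rewrite numer_eq0.
by rewrite (monomial_val_D_fin hD r0 nn) -EFinB lee_fin.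
Qed.

Lemma val_lipschitz z : z != 0 -> exists2 C, 0 <= C &
  forall r s, 0 < r -> 0 < s -> `|val s z - val r z| <= C * `|s - r|.
Proof.
rewrite -numer_eq0 => nn; rewrite /frac_val.
have [C C0 hC] := valD_lipschitz R hD nn.
have [C' C0' hC'] := valD_lipschitz R hD (denom_ratioP (repr z)).
exists (C + C'); first exact: addr_ge0.
move=> r s r0 s0; rewrite ler_norml mulrDl.
have := hC r s r0 s0; have := hC s r s0 r0; rewrite distrC.
have := hC' r s r0 s0; have := hC' s r s0 r0; rewrite distrC.
by move=> *; lra.
Qed.

End ValuationOnK.

(** * Local constancy on a segment, and rings with a length function *)

(** The connectedness of the segment [[a, b]]. *)
Lemma locally_constant_segment (R : realType) (P : R -> Prop) (a b : R) :
  (forall r, a <= r <= b -> exists2 e, 0 < e &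
     forall s, a <= s <= b -> `|s - r| < e -> (P r <-> P s)) ->
  forall r s, a <= r <= b -> a <= s <= b -> P r -> P s.
Proof.
have from_a (Q : R -> Prop) : (forall r, a <= r <= b -> exists2 e, 0 < e &
     forall s, a <= s <= b -> `|s - r| < e -> (Q r <-> Q s)) ->
    Q a -> forall s, a <= s <= b -> Q s.
  move=> locQ Qa s0 /andP[as0 s0b].
  (* Q holds at the supremum of S, and S extends beyond it unless it is s0 *)
  pose S := [set r | a <= r <= s0 /\ forall u, a <= u <= r -> Q u]%classic.
  have Sa : S a.
    split; first by rewrite lexx.
    by move=> u /le_anti <-.
  have Sub : ubound S s0 by move=> r [/andP[]].
  have Ssup : has_sup S by split; [exists a|exists s0].
  have ac : a <= sup S by apply: ub_le_sup => //; exists s0.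
  have cs0 : sup S <= s0 by apply: ge_sup => //; exists a.
  have cb : a <= sup S <= b by rewrite ac (le_trans cs0).
  have [e e0 eP] := locQ _ cb.
  have [r [/andP[ar rs0] Qr] cer] := sup_adherent e0 Ssup.
  have rc : r <= sup S by apply: ub_le_sup; [exists s0|split=> //; rewrite ar].
  have Qc : Q (sup S).
    apply/(eP r); [by rewrite ar (le_trans rs0)| |by apply: Qr; rewrite ar lexx].
    by rewrite ltr_norml; apply/andP; split; lra.
  pose u1 := Num.min s0 (sup S + e / 2).
  have Su1 : S u1.
    split; first by rewrite ge_min lexx le_min as0 /=; lra.
    move=> u /andP[au]; rewrite le_min => /andP[us0 uc].
    have [ur|ru] := leP u r; first by apply: Qr; rewrite au.
    apply/(eP u) => //; first by rewrite au (le_trans us0).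
    by rewrite ltr_norml; apply/andP; split; lra.
  have := ub_le_sup (ex_intro _ s0 Sub) Su1; rewrite ge_min => /orP[s0c|]; last lra.
  by case: Su1 => _; apply; rewrite as0 le_min lexx; lra.
move=> locP r s rI sI Pr.
have aI : a <= a <= b by case/andP: rI => ar rb; rewrite lexx (le_trans ar).
have [Pa|nPa] := pselect (P a); first exact: from_a.
suff : ~ P r by [].
apply: (from_a (fun r => ~ P r)) => // u uI; have [e e0 eP] := locP u uI.
by exists e => // v vI /(eP v vI) h; split; apply: contra_not; apply h.
Qed.

(** In an ascending chain of nonzero principal ideals the length of the
    generators decreases until the quotients are units, and a proper factor has
    smaller length. *)
Lemma accp_atomic_of_length (A : idomainType) (len : A -> nat) :
  (forall u v, u != 0 -> v != 0 -> len (u * v) = (len u + len v)%N) ->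
  (forall u, u != 0 -> len u = 0%N <-> u \is a GRing.unit) ->
  accp A /\ atomic A.
Proof.
move=> lenM len0; split.
- move=> f finc.
  have fle n m : (n <= m)%N -> (principal_ideal (f n) `<=` principal_ideal (f m))%classic.
    move/subnK <-; elim: (m - n)%N => // k IH z /IH; exact: finc.
  have fdiv n m : (n <= m)%N -> exists t, f n = f m * t.
    by move=> /fle; apply; exists 1; rewrite mulr1.
  have [[n0 fn0]|f0] := pselect (exists n, f n != 0); last first.
    exists 0%N => n _; have z k : f k = 0.
      by apply/eqP; apply: contrapT => /negP fk; apply: f0; exists k.
    by rewrite !z.
  have fn n : (n0 <= n)%N -> f n != 0.
    by move=> /fdiv[t e]; apply: contraNneq fn0; rewrite e => ->; rewrite mul0r.
  have ex : exists k, `[< exists2 n, (n0 <= n)%N & len (f n) = k >].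
    by exists (len (f n0)); apply/asboolP; exists n0.
  case: (ex_minnP ex) => k /asboolP[N leN lenN] mink; exists N => n leNn.
  have n0n := leq_trans leN leNn.
  have [t fNE] := fdiv N n leNn.
  have tn0 : t != 0.
    by apply: contraNneq (fn N leN); rewrite fNE => ->; rewrite mulr0.
  have tu : t \is a GRing.unit.
    apply/(len0 t tn0); have : (k <= len (f n))%N.
      by apply: mink; apply/asboolP; exists n.
    by rewrite -lenN fNE lenM // ?fn // -{2}[len (f n)]addn0 leq_add2l leqn0 => /eqP.
  apply/seteqP; split; last exact: fle.
  by move=> z [c ->]; exists (t^-1 * c); rewrite fNE -mulrA mulVKr.
- move=> z; have [n] := ubnP (len z); elim: n z => // n IH z lenz zn0 zu.
  have [zirr|zred] := pselect (irreducible_elt z).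
    by exists [:: z]; rewrite big_seq1; split=> // p; rewrite inE => /eqP->.
  have [s [t [zE su tu]]] : exists s t,
      [/\ z = s * t, s \isn't a GRing.unit & t \isn't a GRing.unit].
    apply: contrapT => no; apply: zred; split=> // s t zE.
    have [su|su] := boolP (s \is a GRing.unit); first by left.
    have [tu|tu] := boolP (t \is a GRing.unit); first by right.
    by case: no; exists s, t.
  have sn0 : s != 0 by apply: contraNneq zn0; rewrite zE => ->; rewrite mul0r.
  have tn0 : t != 0 by apply: contraNneq zn0; rewrite zE => ->; rewrite mulr0.
  have lens : (0 < len s)%N by rewrite lt0n; apply: contra su => /eqP /(len0 s sn0).
  have lent : (0 < len t)%N by rewrite lt0n; apply: contra tu => /eqP /(len0 t tn0).
  move: lenz; rewrite zE lenM // ltnS => lenz.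
  have [|S [Sirr SE]] := IH s _ sn0 su.
    by apply: leq_trans lenz; rewrite -[X in (X < _)%N]addn0 ltn_add2l.
  have [|U [Uirr UE]] := IH t _ tn0 tu.
    by apply: leq_trans lenz; rewrite -[X in (X < _)%N]add0n ltn_add2r.
  exists (S ++ U); rewrite big_cat /= -SE -UE; split=> // p.
  by rewrite mem_cat => /orP[/Sirr|/Uirr].
Qed.


(** * The rings V_r and their maximal ideals *)

Section MonomialValuationRing.
Variables (D : idomainType) (R : realType) (x y : D).
Hypothesis hD : two_dim_local x y.
Local Notation K := {fraction D}.
Local Notation "d %:F" := (@FracField.tofrac D d).
Implicit Types (r : R) (z w : K) (V : {pred K}).
Local Notation val := (frac_val x y).

(** The maximal ideal of [monomial_valring x y r], for positive [r]. *)
Definition monomial_max r : {pred K} := [pred z | (z == 0) || (0 < val r z)].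

Lemma monomial_maxE r z : (z \in monomial_max r) = (z == 0) || (0 < val r z).
Proof. by []. Qed.

Lemma monomial_maxD r z w : 0 < r ->
  z \in monomial_max r -> w \in monomial_max r -> z + w \in monomial_max r.
Proof.
move=> r0; rewrite !monomial_maxE.
have [->|zn0] := eqVneq z 0; first by rewrite add0r.
have [->|wn0] := eqVneq w 0; first by rewrite addr0 (negPf zn0).
have [//|s0] := eqVneq (z + w) 0; move=> /= vz vw.
apply: (@lt_le_trans _ _ (Num.min (val r z) (val r w))); first by rewrite lt_min vz.
by apply: (val_add hD) => //; rewrite ge_min lexx ?orbT.
Qed.

Lemma monomial_maxN r z : 0 < r -> z \in monomial_max r -> - z \in monomial_max r.
Proof.
move=> r0; rewrite !monomial_maxE oppr_eq0; have [//|zn0 /=] := eqVneq z 0.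
by rewrite (valN hD).
Qed.

Lemma monomial_maxM r z w : 0 < r -> z \in monomial_valring x y r ->
  w \in monomial_max r -> z * w \in monomial_max r.
Proof.
move=> r0; rewrite (monomial_valringE hD) // !monomial_maxE mulf_eq0.
have [//|zn0] := eqVneq z 0; have [//|wn0 /= vz vw] := eqVneq w 0.
by rewrite (valM hD) // ltr_wpDl.
Qed.

Lemma monomial_valring_closed r : 0 < r -> subring_closed (monomial_valring x y r).
Proof.
move=> r0; split=> [|z w|z w]; rewrite !(monomial_valringE hD _ r0).
- by rewrite (val1 hD) // lexx orbT.
- have [->|wn0] := eqVneq w 0; first by rewrite subr0.
  have [->|zn0] := eqVneq z 0.
    by rewrite sub0r oppr_eq0 (negPf wn0) (valN hD).
  have [//|s0 /= vz vw] := eqVneq (z - w) 0.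
  by apply: (val_add hD) => //; rewrite ?oppr_eq0 ?(valN hD).
- rewrite mulf_eq0; have [//|zn0] := eqVneq z 0; have [//|wn0 /= vz vw] := eqVneq w 0.
  by rewrite (valM hD) // addr_ge0.
Qed.

Lemma monomial_valring_valuation r : 0 < r -> valuation_ring (monomial_valring x y r).
Proof.
move=> r0; split; first exact: monomial_valring_closed.
move=> z zn0; rewrite !(monomial_valringE hD _ r0) invr_eq0 (negPf zn0) /= (valV hD) //.
by rewrite oppr_ge0; exact: le_total.
Qed.

Lemma monomial_valring_tofrac r d : 0 < r -> d%:F \in monomial_valring x y r.
Proof.
move=> r0; rewrite (monomial_valringE hD _ r0) tofrac_eq0.
by have [//|dn0 /=] := eqVneq d 0; rewrite (val_tofrac hD) // (valD_ge0 hD).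
Qed.

Lemma monomial_max_nonunit r d : 0 < r -> d \isn't a GRing.unit -> d%:F \in monomial_max r.
Proof.
move=> r0 du; rewrite monomial_maxE tofrac_eq0.
by have [//|dn0 /=] := eqVneq d 0; rewrite (val_tofrac hD) // (valD_nonunit hD).
Qed.

Lemma monomial_max_sub_valring r z : 0 < r -> z \in monomial_max r -> z \in monomial_valring x y r.
Proof.
by move=> r0; rewrite (monomial_valringE hD _ r0) monomial_maxE => /orP[->//|/ltW->]; rewrite orbT.
Qed.

Lemma monomial_max_sub_valuation r V z : 0 < r -> valuation_ring V ->
  {subset V <= monomial_valring x y r} -> z \in monomial_max r -> z \in V.
Proof.
move=> r0 [[V1 VB _] Vval] Vr; rewrite monomial_maxE.
have [-> _|zn0 /= vz] := eqVneq z 0; first by rewrite -(subrr 1) VB.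
case/orP: (Vval z zn0) => // /Vr.
by rewrite (monomial_valringE hD _ r0) invr_eq0 (negPf zn0) (valV hD) //= oppr_ge0 leNgt vz.
Qed.

(** As [val r] takes values in the archimedean group of reals, a subring
    containing the maximal ideal of its valuation ring and some element of
    negative value is the whole field. *)
Lemma sub_monomial_valring r V w : 0 < r -> subring_closed V ->
  {subset monomial_max r <= V} -> w \notin V -> {subset V <= monomial_valring x y r}.
Proof.
move=> r0 [V1 _ VM] pV wV z zV; rewrite (monomial_valringE hD _ r0).
have [//|zn0 /=] := eqVneq z 0; rewrite leNgt; apply/negP => vz.
case/negP: wV; have [->|wn0] := eqVneq w 0; first by apply: pV; rewrite monomial_maxE eqxx.
have [n hn] : exists n : nat, - val r w < n%:R * - val r z.
  have := archi_boundP (normr_ge0 (val r w / val r z)).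
  set n := Num.bound _ => hn; exists n; rewrite -ltr_pdivrMr ?oppr_gt0 //.
  by rewrite invrN mulrNN (le_lt_trans (ler_norm _) hn).
have zX k : z ^+ k \in V by elim: k => [|k IH]; rewrite ?expr0 // exprS VM.
have -> : w = z ^+ n * (w * (z ^+ n)^-1) by rewrite mulrCA divff ?mulr1 // expf_neq0.
apply: VM => //; apply: pV; rewrite monomial_maxE (valM hD) ?invr_eq0 ?expf_neq0 //.
rewrite (valV hD) ?expf_neq0 // (valX hD) // mulf_eq0 invr_eq0 (negPf wn0) expf_eq0.
rewrite (negPf zn0) andbF /=; move: hn; rewrite -mulr_natl; lra.
Qed.

Lemma val_gt0_near r z : 0 < r -> z != 0 -> 0 < val r z ->
  exists2 e, 0 < e & forall s, 0 < s -> `|s - r| < e -> 0 < val s z.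
Proof.
move=> r0 zn0 vz; have [C C0 hC] := val_lipschitz R hD zn0.
have C1 : 0 < C + 1 by rewrite ltr_wpDl.
exists (val r z / (C + 1)); first exact: divr_gt0.
move=> s s0; rewrite ltr_pdivlMr // => lt.
have := hC r s r0 s0; rewrite ler_norml => /andP[lo _].
by have := normr_ge0 (s - r); move: lt lo; rewrite mulrDr mulr1 [_ * C]mulrC; lra.
Qed.

End MonomialValuationRing.

(** * Units of the interval ring *)

Section IntervalRingUnits.
Variables (D : idomainType) (R : realType) (x y : D) (a b : R).
Hypothesis hD : two_dim_local x y.
Hypothesis a_gt0 : 0 < a.
Local Notation K := {fraction D}.
Local Notation "d %:F" := (@FracField.tofrac D d).
Local Notation T := (interval_ring_pred x y `[a, b]).
Local Notation val := (frac_val x y).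
Local Notation monomial_max := (monomial_max x y).
Implicit Types (r s : R) (t z : K).

Lemma interval_gt0 r : a <= r <= b -> 0 < r.
Proof. by case/andP => ar _; exact: lt_le_trans ar. Qed.

Lemma interval_ring_tofrac d : d%:F \in T.
Proof. by apply/asboolP => V _ VD _; exact: VD. Qed.

Lemma interval_ring_val_ge0 r t : a <= r <= b -> t \in T -> t != 0 -> 0 <= val r t.
Proof.
move=> rI /asboolP tT tn0; have r0 := interval_gt0 rI.
have := tT _ (monomial_valring_valuation hD r0).
rewrite (monomial_valringE hD _ r0) (negPf tn0) /=; apply.
  by move=> d; exact: (monomial_valring_tofrac hD d r0).
by exists r; rewrite ?in_itv.
Qed.

Lemma interval_ring_sub_valring r t : a <= r <= b -> t \in T -> t \in monomial_valring x y r.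
Proof.
move=> rI tT; rewrite (monomial_valringE hD _ (interval_gt0 rI)).
by have [//|/interval_ring_val_ge0->] := eqVneq t 0.
Qed.

Definition base_ring : {pred K} := [pred z | `[< exists d, z = d%:F >]].

Lemma base_ring_closed : subring_closed base_ring.
Proof.
split=> [|z w /asboolP[c ->] /asboolP[d ->]|z w /asboolP[c ->] /asboolP[d ->]];
  apply/asboolP; first by exists 1.
  by exists (c - d); rewrite tofracB.
by exists (c * d); rewrite tofracM.
Qed.

HB.instance Definition _ := GRing.isSubringClosed.Build K base_ring base_ring_closed.

(** If [t] were not in the subring D[1/t] + M_r, a valuation ring containing this
    subring but not [t] would be one of those whose intersection is [T]. *)
Lemma interval_ring_equation r t : a <= r <= b -> t \in T -> t != 0 -> val r t = 0 ->
  exists n (c : nat -> D) m,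
    m \in monomial_max r /\ t = \sum_(i < n) (c i)%:F * t^-1 ^+ i + m.
Proof.
move=> rI tT tn0 vt0; have r0 := interval_gt0 rI.
pose VS : subringClosed K := HB.pack (monomial_valring x y r)
  (GRing.isSubringClosed.Build K _ (monomial_valring_closed hD r0)).
have tVS : t^-1 \in VS.
  rewrite [_ \in _](monomial_valringE hD _ r0) invr_eq0 (negPf tn0) /=.
  by rewrite (valV hD) // vt0 oppr0.
have adjVS z : z \in adjoin base_ring t^-1 -> z \in VS.
  move=> /adjoinP[q /polyOverP qb ->]; rewrite horner_coef rpred_sum // => i _.
  rewrite rpredM ?rpredX //; have /asboolP[d ->] := qb i.
  exact: monomial_valring_tofrac.
have [adj1 adjB adjM] := adjoin_closed base_ring t^-1.
pose A : {pred K} := [pred z |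
  `[< exists2 u, u \in adjoin base_ring t^-1 & z - u \in monomial_max r >]].
have adjA z : z \in adjoin base_ring t^-1 -> z \in A.
  by move=> hz; apply/asboolP; exists z => //; rewrite subrr monomial_maxE eqxx.
have Aclosed : subring_closed A.
  split=> [|z w|z w]; first exact: adjA.
    move=> /asboolP[u hu zu] /asboolP[v hv wv]; apply/asboolP.
    exists (u - v); first exact: adjB.
    have -> : z - w - (u - v) = (z - u) + - (w - v) by ring.
    by apply: (monomial_maxD hD) => //; exact: (monomial_maxN hD).
  move=> /asboolP[u hu zu] /asboolP[v hv wv]; apply/asboolP.
  exists (u * v); first exact: adjM.
  have -> : z * w - u * v = (u + (z - u)) * (w - v) + v * (z - u) by ring.
  apply: (monomial_maxD hD) => //; apply: (monomial_maxM hD) => //; last exact: adjVS.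
  have zuV : z - u \in VS by exact: (monomial_max_sub_valring hD r0 zu).
  exact: (rpredD (adjVS u hu) zuV).
suff /asboolP[u /adjoinP[q /polyOverP qb ->] hm] : t \in A.
  have /choice[c cE] : forall i, exists d, q`_i = d%:F by move=> i; apply/asboolP/qb.
  exists (size q), c, (t - q.[t^-1]); split=> //.
  rewrite [in LHS](_ : t = q.[t^-1] + (t - q.[t^-1])); last by ring.
  congr (_ + _); rewrite horner_coef; apply: eq_bigr => i _; by rewrite cE.
apply: contraT => tA.
have [V [Vring Vval AV tV]] :=
  exists_valuation_ring_avoiding Aclosed (adjA _ (adjoin_gen _ _)) tA.
case/negP: (tV); have /asboolP := tT; apply.
- by split.
- move=> d; apply/AV/adjA/adjoin_base; apply/asboolP; by exists d.
exists r; first by rewrite in_itv.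
apply: (sub_monomial_valring hD (w := t) r0 Vring) => //.
move=> m hm; apply/AV/asboolP; exists 0; last by rewrite subr0.
by rewrite -(subrr 1); exact: adjB.
Qed.

(** In the equation for [t], a last coefficient that is not a unit contributes an
    element of M_r; when it is a unit, multiplying by a power of [t] and dividing
    by the coefficient gives the inverse [p] modulo M_r. *)
Lemma interval_ring_invertible_mod r t : a <= r <= b -> t \in T -> t != 0 -> val r t = 0 ->
  exists2 p, p \in T & t * p - 1 \in monomial_max r.
Proof.
move=> rI tT tn0 vt0; have r0 := interval_gt0 rI.
have [n [c [m [hm]]]] := interval_ring_equation rI tT tn0 vt0.
elim: n m hm => [|n IH] m hm.
  by rewrite big_ord0 add0r => e; move: hm; rewrite monomial_maxE -e (negPf tn0) vt0 ltxx.
rewrite big_ord_recr /=; set S := \sum_(i < n) _ => tE.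
have [cu|cu] := boolP (c n \is a GRing.unit); last first.
  apply: (IH ((c n)%:F * t^-1 ^+ n + m)); last by rewrite addrA.
  apply: (monomial_maxD hD) => //; rewrite mulrC; apply: (monomial_maxM hD) => //.
    rewrite (monomial_valringE hD _ r0) expf_eq0 invr_eq0 (negPf tn0) andbF /=.
    by rewrite (valX hD) ?invr_eq0 // (valV hD) // vt0 oppr0 mul0rn.
  exact: (monomial_max_nonunit hD).
pose d := ((c n)^-1)%:F.
have dc : d * (c n)%:F = 1 by rewrite -tofracM mulVr.
have dT : d \in T by exact: interval_ring_tofrac.
pose p := d * (t ^+ n - \sum_(i < n) (c i)%:F * t ^+ (n.-1 - i)).
exists p.
  rewrite /p rpredM // rpredB ?rpredX // rpred_sum // => i _.
  by rewrite rpredM ?rpredX // interval_ring_tofrac.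
have tnE : t ^+ n * S = t * \sum_(i < n) (c i)%:F * t ^+ (n.-1 - i).
  rewrite /S !mulr_sumr; apply: eq_bigr => i _.
  have -> : t ^+ n = t ^+ i * (t * t ^+ (n.-1 - i)).
    by rewrite -exprS -exprD -addSnnS -subn1 -subnDA add1n subnKC.
  rewrite exprVn [_ / _]mulrC mulrACA divff ?expf_neq0 // mul1r.
  by rewrite -mulrA [X in t * X]mulrC.
have e : t ^+ n * t = t ^+ n * S + (c n)%:F + t ^+ n * m.
  by rewrite [X in _ * X = _]tE !mulrDr [t ^+ n * (_ * _)]mulrCA -exprMn divff // expr1n mulr1.
have -> : t * p - 1 = d * t ^+ n * m.
  have -> : t * p = d * (t ^+ n * t - t ^+ n * S) by rewrite tnE /p; ring.
  by rewrite e -dc; ring.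
apply: (monomial_maxM hD) => //; apply: interval_ring_sub_valring => //.
by rewrite rpredM // rpredX.
Qed.

(** Near [r] the element [m = t * p - 1] still has positive value, while
    [t * p = 1 + m] would have positive value together with [t]. *)
Lemma val_eq0_near r t : a <= r <= b -> t \in T -> t != 0 -> val r t = 0 ->
  exists2 e, 0 < e & forall s, a <= s <= b -> `|s - r| < e -> val s t = 0.
Proof.
move=> rI tT tn0 vt0; have r0 := interval_gt0 rI.
have [p pT] := interval_ring_invertible_mod rI tT tn0 vt0.
set m := t * p - 1 => hm.
have pn0 : p != 0.
  apply: contraTneq hm => p0; rewrite /m p0 mulr0 sub0r monomial_maxE oppr_eq0 oner_eq0 /=.
  by rewrite (valN hD) ?oner_eq0 // (val1 hD) // ltxx.
have tpE : t * p = 1 + m by rewrite /m; ring.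
have [e e0 me] : exists2 e, 0 < e &
    forall s, 0 < s -> `|s - r| < e -> m \in monomial_max s.
  move: hm; rewrite monomial_maxE; have [m0 _|mn0 /= vm] := eqVneq m 0.
    by exists 1 => // s s0 _; rewrite monomial_maxE m0 eqxx.
  have [e e0 he] := val_gt0_near hD r0 mn0 vm.
  by exists e => // s s0 /he h; rewrite monomial_maxE h ?orbT.
exists e => // s sI ltse; have s0 := interval_gt0 sI.
apply/eqP; rewrite eq_le interval_ring_val_ge0 // andbT leNgt; apply/negP => vt.
have : 1 \in monomial_max s.
  have -> : 1 = t * p + - m by rewrite tpE; ring.
  apply: (monomial_maxD hD) => //; last by apply: (monomial_maxN hD) => //; exact: me.
  rewrite mulrC; apply: (monomial_maxM hD) => //; first exact: interval_ring_sub_valring.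
  by rewrite monomial_maxE vt orbT.
by rewrite monomial_maxE oner_eq0 (val1 hD) // ltxx.
Qed.

Lemma val_eq0_everywhere r s t : a <= r <= b -> a <= s <= b ->
  t \in T -> t != 0 -> val r t = 0 -> val s t = 0.
Proof.
move=> rI sI tT tn0.
apply: (@locally_constant_segment _ (fun u => val u t = 0) a b) => // {rI}r rI.
have r0 := interval_gt0 rI.
have [v0|vn0] := eqVneq (val r t) 0.
  have [e e0 he] := val_eq0_near rI tT tn0 v0.
  by exists e => // u uI lt; split=> // _; exact: he.
have vt : 0 < val r t by rewrite lt_def vn0 interval_ring_val_ge0.
have [e e0 he] := val_gt0_near hD r0 tn0 vt.
exists e => // u uI lt; split=> v0; first by rewrite v0 eqxx in vn0.
by have := he u (interval_gt0 uI) lt; rewrite v0 ltxx.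
Qed.

(** A valuation ring [V] inside V_r contains M_r, so it contains the inverse of
    [1 + m = t * p], with [m] in M_r. *)
Lemma interval_ring_invr t : t \in T -> t != 0 -> (forall r, a <= r <= b -> val r t = 0) ->
  t^-1 \in T.
Proof.
move=> tT tn0 vt0; apply/asboolP => V Vval VD [r]; rewrite in_itv /= => rI Vr.
have r0 := interval_gt0 rI.
have [p pT hm] := interval_ring_invertible_mod rI tT tn0 (vt0 r rI).
set m := t * p - 1 in hm; have tpE : t * p = 1 + m by rewrite /m; ring.
have rI' : r \in `[a, b] by rewrite in_itv.
have pV : p \in V by move/asboolP: pT; apply=> //; exists r.
have [[V1 VB VM] _] := Vval.
have posV z : z \in monomial_max r -> z \in V.
  exact: (monomial_max_sub_valuation hD r0 Vval Vr).
have dn0 : 1 + m != 0.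
  apply/eqP => /eqP; rewrite addrC addr_eq0 => /eqP m1; move: hm.
  by rewrite m1 monomial_maxE oppr_eq0 oner_eq0 (valN hD) ?oner_eq0 // (val1 hD) // ltxx.
have v1m : val r (1 + m) = 0.
  rewrite -tpE; have pn0 : p != 0.
    by apply: contraNneq dn0 => p0; rewrite -tpE p0 mulr0.
  apply/eqP; rewrite eq_le [_ <= 0]leNgt; apply/andP; split; last first.
    by rewrite (valM hD) // addr_ge0 // interval_ring_val_ge0.
  apply/negP => v; have : 1 \in monomial_max r.
    have -> : 1 = t * p + - m by rewrite tpE; ring.
    apply: (monomial_maxD hD) => //; last exact: (monomial_maxN hD).
    by rewrite monomial_maxE v orbT.
  by rewrite monomial_maxE oner_eq0 (val1 hD) // ltxx.
have dV : (1 + m)^-1 \in V.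
  have -> : (1 + m)^-1 = 1 - (1 + m)^-1 * m.
    by apply: (mulfI dn0); rewrite mulrBr mulrA divff //; ring.
  apply: VB => //; apply: posV; apply: (monomial_maxM hD) => //.
  by rewrite (monomial_valringE hD _ r0) (valV hD) // v1m oppr0 lexx orbT.
have -> : t^-1 = p * (1 + m)^-1.
  by apply: (mulfI tn0); rewrite divff // mulrA tpE divff.
exact: VM.
Qed.

End IntervalRingUnits.

Theorem mainTheorem6 (D : idomainType) (R : realType) (x y : D) (a b : R)
    (hD : regular_local_ring2 x y) (ha : 0 < a) (hab : a < b) :
  accp (interval_ring x y `[a, b]) /\ atomic (interval_ring x y `[a, b]).
Proof.
have hD' := two_dim_local_of_regular hD.
have [q] := rat_in_itvoo hab; rewrite in_itv /= => /andP[aq qb].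
set r : R := ratr q; have rI : a <= r <= b by rewrite !ltW.
have r0 : 0 < r by exact: lt_trans aq.
have den0 : 0 < (denq q)%:~R :> R by rewrite ltr0z denq_gt0.
set T := interval_ring x y `[a, b].
have inT (z : T) : val z \in interval_ring_pred x y `[a, b] := valP z.
have val0 (z : T) : (val z == 0) = (z == 0) by rewrite -(inj_eq val_inj) rmorph0.
have /choice[len lenE] (z : T) : exists n : nat, z != 0 ->
    frac_val x y r (val z) * (denq q)%:~R = n%:R.
  have [->|zn0] := eqVneq z 0; first by exists 0%N.
  have vz : 0 <= frac_val x y r (val z).
    by apply: (interval_ring_val_ge0 hD' ha rI (inT z)); rewrite val0.
  have nn : \n_(repr (val z)) != 0 by rewrite numer_eq0 val0.
  have [n nE] := valD_rational hD' r0 nn.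
  have [m mE] := valD_rational hD' r0 (denom_ratioP (repr (val z))).
  exists (n - m)%N => _; rewrite /frac_val mulrBl nE mE natrB //.
  by rewrite -(ler_nat R) -nE -mE ler_pM2r // -subr_ge0.
have valTM (u v : T) : val (u * v) = val u * val v by [].
have val_neq0 (z : T) : z != 0 -> val z != 0 by rewrite val0.
have lenM (u v : T) : u != 0 -> v != 0 -> len (u * v) = (len u + len v)%N.
  move=> un0 vn0; have := lenE (u * v) (mulf_neq0 un0 vn0).
  rewrite valTM (valM hD' r0 (val_neq0 u un0) (val_neq0 v vn0)) mulrDl.
  rewrite (lenE u un0) (lenE v vn0) -natrD => /eqP.
  by rewrite eqr_nat => /eqP.
apply: (@accp_atomic_of_length _ len lenM) => u un0; split=> [lu|uu].
  have vu0 : frac_val x y r (val u) = 0.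
    by have /eqP := lenE u un0; rewrite lu mulf_eq0 (gt_eqF den0) orbF => /eqP.
  have uVT : (val u)^-1 \in interval_ring_pred x y `[a, b].
    apply: (interval_ring_invr hD' ha (inT u) (val_neq0 u un0)) => s sI.
    exact: (val_eq0_everywhere hD' ha rI sI (inT u) (val_neq0 u un0) vu0).
  pose v : T := IntervalRing uVT.
  have vu1 : v * u = 1 by apply: val_inj; rewrite valTM; exact: (mulVf (val_neq0 u un0)).
  by apply/unitrP; exists v; split; rewrite 1?[u * v]mulrC.
have len1 : len 1 = 0%N.
  have := lenE 1 (oner_neq0 T); rewrite (_ : val (1 : T) = 1) // (val1 hD') // mul0r.
  by move/esym/eqP; rewrite pnatr_eq0 => /eqP.
have := lenM u u^-1 un0; rewrite invr_eq0 divrr // len1 => /(_ un0)/esym/eqP.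
by rewrite addn_eq0 => /andP[/eqP].
Qed.
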